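(* For every nonnegative integer $\ell$ there are a constant $K=K(\ell)>0$ and a positive integer $n_0=n_0(\ell)$ such that the following holds for all integers $n\geq n_0$. If $A \subseteq \mathbb{R}_{>0}$ is an $n$-element set with $$|\mathrm{FS}(A)| <(\ell+2)\left(\binom{n-\ell}{2}+1\right)+\binom{\ell+2}{3},$$ then there is a decomposition $A=A_1 \sqcup A_2$ (disjoint union) such that: (i) there is some $r \in \mathbb{R}_{>0}$ with $A_1 \subseteq r\cdot\mathbb{Z}_{>0}$ and $\sum_{x \in r^{-1}\cdot A_1}x \leq K n^2$; and (ii) $|A_2|\leq \ell$.
   Context: For a finite subset $A$ of an abelian group, $\mathrm{FS}(A):=\{\sum_{x\in B}x : B\subseteq A\}$ is the set of subset sums of $A$ (the empty subset gives $0$). For a nonzero real $c$ and a set $X$ of reals, $c\cdot X:=\{cx: x\in X\}$. *)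

(* Defs.v *)
From mathcomp Require Import all_boot all_order all_algebra finmap.
From mathcomp Require Import all_classical all_reals.

Set Implicit Arguments.
Unset Strict Implicit.
Unset Printing Implicit Defensive.

Import Order.TTheory GRing.Theory Num.Theory.

Local Open Scope ring_scope.
Local Open Scope fset_scope.
Local Open Scope classical_set_scope.

Definition FS (G : zmodType) (A : {fset G}) : {fset G} :=
  [fset \sum_(x <- B) x | B : {fset G} in fpowerset A]%fset.

Definition dilate (R : realType) (c : R) (X : set R) : set R :=
  [set c * x | x in X].

Definition pos_integers (R : realType) : set R :=
  [set m%:~R | m in [set m : int | 0 < m]].

Arguments pos_integers : clear implicits.

(* Main.v *)
Require Import Defs.
From HB Require Import structures.
From mathcomp Require Import all_boot all_order all_algebra finmap.
From mathcomp Require Import zify ring lra.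
From mathcomp Require Import all_classical all_reals.

(** Why the theorem holds.

    Write [n] for the size of [A] and say that [y] escapes [X] at [z] when [z] is
    in [X] and [z + y] is not. Adjoining [y] to a set with subset sums [X] creates
    exactly as many new sums as there are such points [z]; this number,
    [escape X y], is invariant under [y -> - y] and subadditive in [y], and at most
    [2 * #|X|] elements [y] have [escape X y] at most half of [#|X|]
    ([card_small_escape]).

    Rough structure. As there are [O(n ^ 2)] sums, a greedy choice splits [A] into
    a part with subset sums [X], where [#|X|] is of order [n ^ 2], and a part [D]
    of proportional size all of whose elements have [escape X d = O(n)]. So signed
    sums of up to [c * n] elements of [D] take only [O(n ^ 2)] values. Let [x] be
    the largest element of [D]. The multiples of [x] alone contribute a factor of
    order [n], which leaves [O(n)] classes modulo [x] for the signed sums of [O(1)]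
    elements of [D], while [D] already occupies a positive proportion of them. Hence
    these classes stop growing after [O(1)] steps ([packing]); they form a finite
    group, which is cyclic, and [D] lies in a progression of ratio [x / q] with
    [q = O(n)] ([progression_core]).

    Let [T] be the set of subset sums of [D]. An element [y] none of whose small
    multiples is a difference in the range of [T] adds at least [#|T|] sums each
    time it is adjoined: from each point of [T], follow the progression of difference
    [y] to its last consecutive term ([escape_ge_chains]). As [#|T|] is of order
    [n ^ 2], only [O(1)] elements are of this kind, and the others can be merged
    into a refined progression, of total [O(n ^ 2)] ([progression_up_to_bounded]).

    Exact count. Now [A] is the union of [A1], in a progression, and of [s]
    exceptional elements, [s] bounded. If [s > l] and an exceptional element has a
    small multiple in the range of the progression, it is absorbed into [A1].
    Otherwise adjoin the exceptional elements to [A1] one by one. If two of them are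
    not congruent up to sign modulo the progression, an additional translate of [T]
    can be gained, and the count exceeds the bound for large [n]. If they are all
    congruent up to sign to [y0], changing signs only translates the sums; the sums
    then split into the classes of [k * y0], and the ordering inside each class
    yields the term ['C(s + 1, 3)] ([exact_count]). *)

Set Implicit Arguments.
Unset Strict Implicit.
Unset Printing Implicit Defensive.

Import Order.TTheory GRing.Theory Num.Theory.

Local Open Scope fset_scope.
Local Open Scope ring_scope.

(** * Subset sums and translates *)

Lemma leq_card_fset_inj (T T' : choiceType) (X : {fset T}) (Y : {fset T'})
    (f : T -> T') :
  {in X &, injective f} -> (forall x, x \in X -> f x \in Y) ->
  (#|` X| <= #|` Y|)%N.
Proof.
move=> fi fXY; rewrite -[leqLHS](size_map f); apply: uniq_leq_size.
  by rewrite map_inj_in_uniq.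
by move=> _ /mapP[x xX ->]; apply: fXY.
Qed.

Definition sumset (G : zmodType) (X Y : {fset G}) : {fset G} :=
  [fset x + y | x in X, y in Y].

Lemma sumsetP (G : zmodType) (X Y : {fset G}) (z : G) :
  reflect (exists x y, [/\ x \in X, y \in Y & z = x + y]) (z \in sumset X Y).
Proof.
apply: (iffP (imfset2P _ _ _ _ _)) => [[x xX [y yY ->]]|[x [y [xX yY ->]]]].
  by exists x, y.
by exists x => //; exists y.
Qed.

Lemma mem_sumset (G : zmodType) (X Y : {fset G}) (x y : G) :
  x \in X -> y \in Y -> x + y \in sumset X Y.
Proof. by move=> xX yY; apply/sumsetP; exists x, y. Qed.

Lemma sumsetA (G : zmodType) : associative (@sumset G).
Proof.
move=> X Y Z; apply/fsetP => w; apply/sumsetP/sumsetP.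
  move=> [x [_ [xX /sumsetP[y [z [yY zZ ->]]] ->]]].
  by exists (x + y), z; rewrite addrA; split=> //; apply: mem_sumset.
move=> [_ [z [/sumsetP[x [y [xX yY ->]]] zZ ->]]].
by exists x, (y + z); rewrite addrA; split=> //; apply: mem_sumset.
Qed.

Lemma sumsetC (G : zmodType) : commutative (@sumset G).
Proof.
by move=> X Y; apply/fsetP => w; apply/sumsetP/sumsetP => -[x [y [? ? ->]]];
  exists y, x; rewrite addrC.
Qed.

Lemma sumset0 (G : zmodType) : left_id [fset 0 : G] (@sumset G).
Proof.
move=> X; apply/fsetP => w; apply/sumsetP/idP => [|wX].
  by move=> [x [y [/[!inE]/eqP-> yX ->]]]; rewrite add0r.
by exists 0, w; rewrite inE add0r.
Qed.

HB.instance Definition _ (G : zmodType) :=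
  Monoid.isComLaw.Build {fset G} [fset 0] (@sumset G)
    (@sumsetA G) (@sumsetC G) (@sumset0 G).

(** Subset sums of a sequence, as an iterated product in the monoid of finite
    sets under sumset: reordering and splitting the sequence are then instances
    of the theory of big operators. *)
Definition subsums (G : zmodType) (s : seq G) : {fset G} :=
  \big[@sumset G/[fset 0]]_(a <- s) [fset 0; a].

Lemma subsums_nil (G : zmodType) : subsums [::] = [fset 0 : G].
Proof. exact: big_nil. Qed.

Lemma subsums_cons (G : zmodType) (a : G) (s : seq G) :
  subsums (a :: s) = sumset [fset 0; a] (subsums s).
Proof. exact: big_cons. Qed.

Lemma subsums_cat (G : zmodType) (s t : seq G) :
  subsums (s ++ t) = sumset (subsums s) (subsums t).
Proof. exact: big_cat. Qed.

Lemma perm_subsums (G : zmodType) (s t : seq G) :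
  perm_eq s t -> subsums s = subsums t.
Proof. exact: perm_big. Qed.

Lemma subsumsP (G : zmodType) (s : seq G) (z : G) :
  reflect (exists2 v, subseq v s & z = \sum_(x <- v) x) (z \in subsums s).
Proof.
elim: s z => [|a s IH] z.
  rewrite subsums_nil inE; apply: (iffP eqP) => [->|[v /[!subseq0]/eqP-> ->]].
    by exists [::]; rewrite ?big_nil.
  by rewrite big_nil.
rewrite subsums_cons; apply: (iffP (sumsetP _ _ _)).
  move=> [x [y [/[!inE]/orP[]/eqP-> /IH[v vs ->] ->]]].
    by exists v; rewrite ?add0r //; apply: subseq_trans vs (subseq_cons _ _).
  by exists (a :: v); rewrite ?big_cons //= eqxx.
move=> [[|b v] /=].
  move=> _ ->; exists 0, 0; rewrite big_nil addr0 !inE eqxx; split=> //.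
  by apply/IH; exists [::]; rewrite ?sub0seq ?big_nil.
have [-> vs ->|_ vs ->] := eqVneq b a.
  exists a, (\sum_(x <- v) x); rewrite big_cons !inE eqxx orbT; split=> //.
  by apply/IH; exists v.
exists 0, (\sum_(x <- b :: v) x); rewrite add0r !inE eqxx; split=> //.
by apply/IH; exists (b :: v).
Qed.

Lemma mem_subsums (G : zmodType) (s v : seq G) :
  subseq v s -> \sum_(x <- v) x \in subsums s.
Proof. by move=> vs; apply/subsumsP; exists v. Qed.

Lemma subsums0 (G : zmodType) (s : seq G) : 0 \in subsums s.
Proof. by rewrite -(big_nil 0 +%R xpredT id) mem_subsums ?sub0seq. Qed.

Lemma subsums_nonempty (G : zmodType) (s : seq G) : (0 < #|` subsums s|)%N.
Proof. by rewrite cardfs_gt0; apply/fset0Pn; exists 0; apply: subsums0. Qed.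

Lemma sumset_fsub (G : zmodType) (X Y Z : {fset G}) :
  X `<=` Y -> sumset X Z `<=` sumset Y Z.
Proof.
move=> /fsubsetP XY; apply/fsubsetP => _ /sumsetP[x [y [/XY xY yZ ->]]].
exact: mem_sumset.
Qed.

(** What adjoining [y] to a set with subset sums [X] adds to the number of
    sums: see [card_sumset_pair]. *)
Definition escape (G : zmodType) (X : {fset G}) (y : G) : nat :=
  #|` [fset z in X | z + y \notin X]|.

Lemma card_sumset_pair (G : zmodType) (X : {fset G}) (y : G) :
  #|` sumset [fset 0; y] X| = (#|` X| + escape X y)%N.
Proof.
have -> : sumset [fset 0; y] X =
    X `|` [fset z + y | z in [fset z in X | z + y \notin X]].
  apply/fsetP => w; rewrite in_fsetU; apply/sumsetP/orP.
    move=> [a [x [/[!inE]/orP[]/eqP-> xX ->]]]; first by left; rewrite add0r.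
    case: (boolP (y + x \in X)) => yx; first by left.
    by right; apply/imfsetP; exists x; rewrite ?inE /= ?xX 1?addrC.
  move=> [wX|/imfsetP[x /[!inE] /andP[xX _] ->]].
    by exists 0, w; rewrite !inE eqxx add0r.
  by exists y, x; rewrite !inE eqxx orbT addrC.
rewrite cardfsU disjoint_fsetI0 ?cardfs0 ?subn0.
  by rewrite card_imfset //=; apply: addIr.
apply/fdisjointP => x xX; apply/negP => /imfsetP[z /[!inE] /andP[_ zy] xE].
by move: zy; rewrite -xE xX.
Qed.

Lemma card_subsums_cons (G : zmodType) (a : G) (s : seq G) :
  #|` subsums (a :: s)| = (#|` subsums s| + escape (subsums s) a)%N.
Proof. by rewrite subsums_cons card_sumset_pair. Qed.

Lemma escape0 (G : zmodType) (X : {fset G}) : escape X 0 = 0%N.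
Proof.
apply/eqP; rewrite cardfs_eq0; apply/eqP/fsetP => z; rewrite !inE addr0.
by case: (z \in X).
Qed.

(** Translation by [y] maps the points of [X] that it keeps in [X] bijectively to
    those that translation by [- y] keeps in [X]. *)
Lemma escapeN (G : zmodType) (X : {fset G}) (y : G) :
  escape X (- y) = escape X y.
Proof.
have E w : escape X w = (#|` X| - #|` [fset z in X | (z + w)%R \in X]|)%N.
  rewrite -cardfsDS; last by apply/fsubsetP => z /[!inE]/andP[].
  by congr #|` _|; apply/fsetP => z; rewrite !inE; case: (z \in X) => /=;
     rewrite ?andbF ?andbT.
have H w : (#|` [fset z in X | (z + w)%R \in X]|
    <= #|` [fset z in X | (z - w)%R \in X]|)%N.
  apply: (@leq_card_fset_inj _ _ _ _ (fun z => z + w)) => [? ? _ _ /addIr //|].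
  by move=> z /[!inE] /andP[zX ->]; rewrite addrK zX.
rewrite !E; congr subn; apply/eqP; rewrite eqn_leq H andbT.
by have := H (- y); rewrite opprK.
Qed.

Lemma escapeD (G : zmodType) (X : {fset G}) (y w : G) :
  (escape X (y + w) <= escape X y + escape X w)%N.
Proof.
pose U := [fset z in X | (z + y \in X) && (z + (y + w) \notin X)].
pose V := [fset z in X | (z + y \notin X) && (z + (y + w) \notin X)].
have -> : escape X (y + w) = #|` V `|` U|.
  congr #|` _|; apply/fsetP => z; rewrite !inE.
  by case: (z \in X); case: (z + y \in X) => //=; case: (_ \in X).
apply: (@leq_trans (#|` V| + #|` U|)%N); first by rewrite -cardfsUI leq_addr.
apply: leq_add.
  by apply/fsubset_leq_card/fsubsetP => z /[!inE] /and3P[-> ->].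
apply: (@leq_card_fset_inj _ _ _ _ (fun z => z + y)) => [? ? _ _ /addIr //|].
by move=> z /[!inE] /and3P[_ -> ?]; rewrite -addrA.
Qed.

(** Each pair of points of [X] has a single difference, so [X] meets few of its
    translates in half of its points. *)
Lemma card_small_escape (G : zmodType) (X Y : {fset G}) :
  (0 < #|` X|)%N -> (forall y, y \in Y -> (2 * escape X y <= #|` X|)%N) ->
  (#|` Y| <= 2 * #|` X|)%N.
Proof.
move=> X0 small.
pose stay y := [seq z <- X | z + y \in X].
pose P := [seq (z, z + y) | y <- Y, z <- stay y].
have Pu : uniq P.
  apply: allpairs_uniq_dep => [|y yY|]; first exact: fset_uniq.
    by rewrite filter_uniq ?fset_uniq.
  by move=> [y1 z1] [y2 z2] /= _ _ [-> /addrI ->].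
have PX : (size P <= #|` X| * #|` X|)%N.
  rewrite -(size_allpairs pair); apply: uniq_leq_size => // p /allpairsPdep /=.
  move=> [y [z [_ /[!mem_filter] /andP[? ?] ->]]]; apply/allpairsP.
  by exists (z, z + y).
have PY : (#|` Y| * #|` X| <= 2 * size P)%N.
  have -> : (#|` Y| * #|` X| = \sum_(y <- Y) #|` X|)%N.
    by rewrite big_const_seq count_predT iter_addn_0 mulnC.
  rewrite size_allpairs_dep sumnE big_map big_distrr /=.
  rewrite big_seq [leqRHS]big_seq; apply: leq_sum => y yY.
  have : (escape X y + size (stay y) = #|` X|)%N.
    rewrite -[RHS](count_predC (fun z => z + y \notin X)) size_filter.
    congr addn; last by apply: eq_count => z /=; rewrite negbK.
    rewrite -size_filter /escape.
    by apply/perm_size/uniq_perm; rewrite ?filter_uniq // => z;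
       rewrite mem_filter !inE andbC.
  move=> H; have := small _ yY; rewrite -H; move: (escape _ _) (size _) => e s; lia.
by rewrite -(leq_pmul2r X0); lia.
Qed.

Lemma escape_ge_size (G : zmodType) (X : {fset G}) (y : G) (Z : seq G) :
  uniq Z -> (forall z, z \in Z -> z \in X /\ z + y \notin X) ->
  (size Z <= escape X y)%N.
Proof.
move=> Zu ZX; apply: uniq_leq_size => // z /ZX[zX zy].
by rewrite !inE zX.
Qed.

Lemma ler_sum_subseq (R : numDomainType) (s v : seq R) :
  (forall x, x \in s -> 0 <= x) -> subseq v s ->
  \sum_(x <- v) x <= \sum_(x <- s) x.
Proof.
elim: s v => [|a s IH] v s0; first by rewrite subseq0 => /eqP->.
have s0' x : x \in s -> 0 <= x by move=> xs; apply: s0; rewrite inE xs orbT.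
case: v => [_|b v] /=.
  by rewrite big_nil big_seq sumr_ge0 // => x; apply: s0.
rewrite [leRHS]big_cons; have [-> vs|_ vs] := eqVneq b a.
  by rewrite big_cons lerD2l IH.
apply: le_trans (IH _ s0' vs) _.
by rewrite lerDr s0 ?mem_head.
Qed.

Lemma sum_rem (G : zmodType) (s : seq G) (x : G) :
  x \in s -> \sum_(y <- rem x s) y = \sum_(y <- s) y - x.
Proof. by move=> xs; rewrite [in RHS](big_rem x xs) /= addrAC subrr add0r. Qed.

Lemma ge_path_max (R : realDomainType) (b : R) (s : seq R) :
  path >=%R b s -> forall x, x \in s -> x <= b.
Proof. by move=> /(order_path_min ge_trans)/allP. Qed.

(** The largest element [b] moves [size s + 1] subset sums of the others beyond
    their total: the total itself, and the total minus any of its terms. *)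
Lemma card_subsums_ge (R : realDomainType) (s : seq R) :
  uniq s -> (forall x, x \in s -> 0 < x) ->
  ('C((size s).+1, 2) + 1 <= #|` subsums s|)%N.
Proof.
rewrite -(perm_uniq (permEl (perm_sort >=%R s))) -(size_sort >=%R s).
rewrite -(perm_subsums (permEl (perm_sort >=%R s))) => u p.
have {p} : forall x, x \in sort >=%R s -> 0 < x.
  by move=> x; rewrite mem_sort; apply: p.
have := sort_sorted (@ge_total _ R) s.
move: (sort _ s) u => {}s; elim: s => [|b s IH] /=.
  by move=> _ _ _; rewrite subsums_nil cardfs1.
move=> /andP[bs us] sb p.
have p' x : x \in s -> 0 < x by move=> xs; apply: p; rewrite inE xs orbT.
have sorts := path_sorted sb.
have {sb} ltb x : x \in s -> x < b.
  move=> xs; rewrite lt_neqAle (ge_path_max sb xs) andbT.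
  by apply: contraNneq bs => <-.
rewrite card_subsums_cons binS bin1 addnAC; apply: leq_add; first exact: IH.
rewrite -[X in (X <= _)%N]/(size (0 :: s)).
rewrite -(size_map (fun x => \sum_(y <- s) y - x)); apply: escape_ge_size.
  rewrite map_inj_uniq /= ?us ?andbT; last by move=> x y /addrI/oppr_inj.
  by apply/negP => /p'; rewrite ltxx.
move=> _ /mapP[x xs ->].
have xb : x < b.
  by move: xs; rewrite inE => /orP[/eqP->|/ltb//]; apply: p; rewrite mem_head.
split.
  move: xs; rewrite inE => /orP[/eqP->|xs].
    by rewrite subr0 mem_subsums.
  by rewrite -sum_rem // mem_subsums // rem_subseq.
apply/negP => /subsumsP[v vs E].
have := ler_sum_subseq (fun x xs => ltW (p' x xs)) vs; rewrite -E.
lra.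
Qed.

(** Feeding in, one after the other, elements whose adjunction creates more than
    [L] new sums either exhausts [p] of them or stops at a stage where all the
    remaining elements create at most [L] new sums. *)
Lemma greedy_small_escape (G : zmodType) (B D : seq G) (p L : nat) :
  (p <= size D)%N ->
  exists E F, perm_eq D (E ++ F) /\ (size E <= p)%N /\
   ((forall y, y \in F -> (escape (subsums (E ++ B)) y <= L)%N) \/
    (p * L.+1 <= #|` subsums (E ++ B)|)%N /\ size E = p).
Proof.
elim: p => [_|p IH pD]; first by exists [::], D; split=> //; split=> //; right.
have [E [F [DEF [Ep H]]]] := IH (ltnW pD).
have [H1|] := pselect (forall y, y \in F -> (escape (subsums (E ++ B)) y <= L)%N).
  by exists E, F; split=> //; split; [lia|left].
case: H => [//|[card_E sE]] H.
have [y yF yL] : exists2 y, y \in F & (L < escape (subsums (E ++ B)) y)%N.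
  apply: contrapT => H1; apply: H => y yF; rewrite leqNgt; apply/negP => yL.
  by apply: H1; exists y.
exists (y :: E), (rem y F); split.
  apply: perm_trans DEF _; rewrite -cat1s -catA perm_sym perm_catCA.
  by rewrite perm_cat2l perm_sym perm_to_rem.
split; first by rewrite /= sE.
right; rewrite cat_cons card_subsums_cons /= sE; split=> //.
by rewrite mulSn addnC leq_add.
Qed.

(** * Word balls and arithmetic progressions *)

(** [ball D j] consists of the signed sums of at most [j] terms of [D], repetitions
    allowed: it is a ball of the word metric of the group generated by [D]. *)
Definition steps (G : zmodType) (D : seq G) : {fset G} :=
  0 |` ([fset d | d in D] `|` [fset - d | d in D]).

Fixpoint ball (G : zmodType) (D : seq G) (j : nat) : {fset G} :=
  if j is j'.+1 then sumset (steps D) (ball D j') else [fset 0].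

Lemma stepsP (G : zmodType) (D : seq G) (z : G) :
  reflect (z = 0 \/ exists2 d, d \in D & z = d \/ z = - d) (z \in steps D).
Proof.
rewrite 3!inE; apply: (iffP or3P) => [[/eqP->|zD|zD]|].
- by left.
- by right; exists z; [move: zD; rewrite !inE|left].
- by right; move: zD => /imfsetP[d dD ->]; exists d => //; right.
move=> [->|[d dD [->|->]]]; first by constructor 1.
  by constructor 2; rewrite !inE.
by constructor 3; apply/imfsetP; exists d.
Qed.

Lemma ballD (G : zmodType) (D : seq G) (i j : nat) :
  ball D (i + j) = sumset (ball D i) (ball D j).
Proof.
by elim: i => [|i IH]; rewrite ?sumset0 // addSn /= IH sumsetA.
Qed.

Lemma mem_ballD (G : zmodType) (D : seq G) (i j : nat) (u v : G) :
  u \in ball D i -> v \in ball D j -> u + v \in ball D (i + j).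
Proof. by rewrite ballD; apply: mem_sumset. Qed.

Lemma ball0 (G : zmodType) (D : seq G) (j : nat) : 0 \in ball D j.
Proof.
elim: j => [|j IH] /=; first by rewrite inE.
by rewrite -[0]addr0; apply: mem_sumset => //; apply/stepsP; left.
Qed.

Lemma leq_ball (G : zmodType) (D : seq G) (i j : nat) (u : G) :
  (i <= j)%N -> u \in ball D i -> u \in ball D j.
Proof.
move=> ij ui; rewrite -(subnK ij) -[u]add0r; apply: mem_ballD => //.
exact: ball0.
Qed.

Lemma mem_ball1 (G : zmodType) (D : seq G) (d : G) : d \in D -> d \in ball D 1.
Proof.
move=> dD; rewrite -[d]addr0; apply: mem_sumset; last by rewrite inE.
by apply/stepsP; right; exists d => //; left.
Qed.

Lemma ballN (G : zmodType) (D : seq G) (j : nat) (u : G) :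
  u \in ball D j -> - u \in ball D j.
Proof.
elim: j u => [|j IH] u /=; first by rewrite !inE oppr_eq0.
move=> /sumsetP[s [v [sD vj ->]]]; rewrite opprD; apply: mem_sumset; last exact: IH.
apply/stepsP; case/stepsP: sD => [->|[d dD [->|->]]]; first by left; rewrite oppr0.
  by right; exists d => //; right.
by right; exists d => //; left; rewrite opprK.
Qed.

Lemma ball_mulrn (G : zmodType) (D : seq G) (d : G) (i : nat) :
  d \in D -> d *+ i \in ball D i.
Proof.
move=> dD; elim: i => [|i IH]; first by rewrite mulr0n ball0.
by rewrite mulrS -add1n; apply: mem_ballD => //; apply: mem_ball1.
Qed.

Lemma escape_ball (G : zmodType) (X : {fset G}) (D : seq G) (L j : nat) (w : G) :
  (forall d, d \in D -> (escape X d <= L)%N) -> w \in ball D j ->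
  (escape X w <= j * L)%N.
Proof.
move=> DL; elim: j w => [|j IH] w /=.
  by rewrite inE => /eqP->; rewrite escape0.
move=> /sumsetP[s [v [sD vj ->]]]; apply: leq_trans (escapeD _ _ _) _.
rewrite mulSn; apply: leq_add; last exact: IH.
by case/stepsP: sD => [->|[d dD [->|->]]]; rewrite ?escapeN ?escape0 ?DL.
Qed.

Definition congr_mod (G : zmodType) (x u v : G) := exists i : int, u = v + x *~ i.

Lemma congr_modD (G : zmodType) (x u v u' v' : G) :
  congr_mod x u v -> congr_mod x u' v' -> congr_mod x (u + u') (v + v').
Proof. by move=> [i ->] [j ->]; exists (i + j); rewrite mulrzDr addrACA. Qed.

Lemma congr_modN (G : zmodType) (x u v : G) :
  congr_mod x u v -> congr_mod x (- u) (- v).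
Proof. by move=> [i ->]; exists (- i); rewrite mulrNz opprD. Qed.

Lemma congr_mod_trans (G : zmodType) (x u v w : G) :
  congr_mod x u v -> congr_mod x v w -> congr_mod x u w.
Proof. by move=> [i ->] [j ->]; exists (j + i); rewrite mulrzDr addrA. Qed.

Lemma congr_mod_sym (G : zmodType) (x u v : G) :
  congr_mod x u v -> congr_mod x v u.
Proof. by move=> [i ->]; exists (- i); rewrite mulrNz addrK. Qed.

Lemma congr_mod_refl (G : zmodType) (x u : G) : congr_mod x u u.
Proof. by exists 0; rewrite mulr0z addr0. Qed.

Lemma mul_int_lt1 (R : realDomainType) (x : R) (i : int) :
  0 < x -> - x < x *~ i < x -> i = 0.
Proof.
move=> x0; rewrite -mulrzr => /andP[xi ix].
have : (-1 : int)%:~R < i%:~R :> R by rewrite -(ltr_pM2l x0) mulrN1.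
have : i%:~R < (1 : int)%:~R :> R by rewrite -(ltr_pM2l x0) mulr1.
by rewrite !ltr_int; lia.
Qed.

Lemma congr_mod_small (R : realDomainType) (x u v : R) :
  0 < x -> - x < u - v < x -> congr_mod x u v -> u = v.
Proof.
move=> x0 uv [i E]; move: uv; rewrite E addrC addKr => /(mul_int_lt1 x0) ->.
by rewrite mulr0z addr0.
Qed.

Lemma block_uniq (R : realDomainType) (D : seq R) (x : R) (m : nat) :
  0 < x -> uniq D -> (forall d, d \in D -> 0 < d <= x) ->
  uniq [seq d + x *+ i | d <- D, i <- iota 0 m].
Proof.
move=> x0 Du Dx; apply: allpairs_uniq => //; first exact: iota_uniq.
move=> p p' /allpairsP[[d i] /= [dD _ ->]].
move=> /allpairsP[[d' i'] /= [dD' _ ->]] /= E.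
have dd : d = d'.
  apply: (congr_mod_small x0); last first.
    exists (i'%:Z - i%:Z); rewrite mulrzBr -!pmulrn.
    by apply: (addIr (x *+ i)); rewrite E addrA subrK.
  have := Dx _ dD; have := Dx _ dD'.
  by move=> /andP[? ?] /andP[? ?]; apply/andP; split; lra.
move: E; rewrite dd => /addrI/(mulrIn (lt0r_neq0 x0)) -> //.
Qed.

(** If the classes modulo [x] reached in [3 * i + 3] steps always exceed those
    reached in [3 * i + 2] steps, then translates of the block of all
    [d + i * x] centred at new points three steps apart are disjoint: a common
    point would connect the two centres in at most two steps. *)
Lemma packing (R : realDomainType) (D : seq R) (x : R) (p m : nat) :
  uniq D -> (forall d, d \in D -> 0 < d <= x) -> x \in D ->
  (forall i, (i < p)%N -> exists2 g, g \in ball D (3 * i + 3) &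
     forall w, w \in ball D (3 * i + 2) -> ~ congr_mod x g w) ->
  (p.+1 * (size D * m.+1) <= #|` ball D (3 * p + 1 + m)|)%N.
Proof.
move=> Du Dx xD; have x0 : 0 < x by have /andP[] := Dx _ xD.
move=> new.
pose F := [seq d + x *+ i | d <- D, i <- iota 0 m.+1].
have Fu : uniq F by apply: block_uniq.
suff [Y [Yu sY YP]] : exists Y : seq R, [/\ uniq Y,
    size Y = (p.+1 * (size D * m.+1))%N &
    forall y, y \in Y -> exists w f, [/\ w \in ball D (3 * p), f \in F & y = w + f]].
  rewrite -sY; apply: uniq_leq_size => // y /YP[w [f [wp]]].
  move=> /allpairsP[[d i] [dD /[!mem_iota] im ->]] ->; rewrite /= in dD im *.
  rewrite -addnA; apply: mem_ballD => //.
  apply: mem_ballD; first exact: mem_ball1.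
  apply: leq_ball (ball_mulrn _ xD); lia.
elim: p new => [|p IH] new.
  exists F; split=> //; first by rewrite size_allpairs size_iota mul1n.
  by move=> y yF; exists 0, y; rewrite add0r inE.
have [//|Y [Yu sY YP]] := IH; first by move=> i ip; apply: new; lia.
have [//|g gp gnew] := new p; exists (Y ++ [seq g + f | f <- F]); split.
- rewrite cat_uniq Yu (map_inj_uniq (@addrI _ g)) Fu andbT.
  apply/hasPn => _ /mapP[f fF ->]; apply/negP => /YP[w [f' [wp fF' E]]].
  move: fF fF' => /allpairsP[[d i] /= [dD im Ef]] /allpairsP[[d' i'] /= [dD' im' Ef']].
  apply: (gnew (w + (d' - d))).
    apply: mem_ballD => //; apply: (@mem_ballD _ _ 1 1); first exact: mem_ball1.
    by apply: ballN; apply: mem_ball1.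
  exists (i'%:Z - i%:Z); rewrite mulrzBr -!pmulrn.
  by apply: (addIr f); rewrite E Ef Ef'; ring.
- by rewrite size_cat sY size_map size_allpairs size_iota mulSn addnC.
move=> y; rewrite mem_cat => /orP[/YP[w [f [wp fF ->]]]|/mapP[f fF ->]].
  by exists w, f; split=> //; apply: leq_ball wp; lia.
by exists g, f; split=> //; apply: leq_ball gp; lia.
Qed.

Lemma exists_min (R : realDomainType) (x : R) (s : seq R) :
  exists2 r, r \in x :: s & forall u, u \in x :: s -> r <= u.
Proof.
elim: s x => [|y s IH] x.
  by exists x; rewrite ?mem_head // => u; rewrite inE => /eqP->.
have [r rs rmin] := IH y.
have [xr|rx] := leP x r.
  exists x; rewrite ?mem_head // => u; rewrite inE => /orP[/eqP->//|/rmin].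
  exact: le_trans.
exists r; first by rewrite inE rs orbT.
by move=> u; rewrite inE => /orP[/eqP->|/rmin//]; apply: ltW.
Qed.

(** When the [ball D t] already meets every class modulo [x] met by the larger
    balls, these classes form a finite subgroup of the circle of length [x],
    and finite subgroups of a circle are cyclic: [D] lies in the multiples of
    the smallest positive element [r] of that subgroup. The number [q] of
    classes is read off from the block of all [u + i * x] that they span. *)
Lemma progression_of_stable (R : realType) (D : seq R) (x : R) (t m : nat) :
  (forall d, d \in D -> 0 < d <= x) -> x \in D ->
  (forall g, g \in ball D t.+1 -> exists2 w, w \in ball D t & congr_mod x g w) ->
  exists r q, [/\ 0 < r, (q * m.+1 <= #|` ball D (t + m)|)%N &
    forall d, d \in D -> exists2 k, (0 < k <= q)%N & d = r * k%:R].
Proof.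
move=> Dx xD stable; have x0 : 0 < x by have /andP[] := Dx _ xD.
pose H u := exists2 w, w \in ball D t & congr_mod x u w.
have ballH j w : w \in ball D j -> H w.
  elim: j w => [|j IH] w /=.
    by rewrite inE => /eqP->; exists 0; [apply: ball0|apply: congr_mod_refl].
  move=> /sumsetP[s [v [sD /IH[v' v't vv'] ->]]].
  have [|w' w't ww'] := stable (s + v'); first exact: mem_sumset.
  exists w' => //; apply: congr_mod_trans ww'.
  by apply: congr_modD => //; apply: congr_mod_refl.
have Hcongr u v : congr_mod x u v -> H v -> H u.
  by move=> uv [w wt vw]; exists w => //; apply: congr_mod_trans uv vw.
have Hsub u v : H u -> H v -> H (u - v).
  move=> [u' u't uu'] [v' v't vv']; apply: (Hcongr _ (u' - v')).
    by apply: congr_modD => //; apply: congr_modN.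
  by apply: ballH; apply: mem_ballD u't _; apply: ballN v't.
have H0 : H 0 by apply: (ballH 0%N); rewrite inE.
have HMn u i : H u -> H (u *+ i).
  move=> Hu; elim: i => [|i IH]; first by rewrite mulr0n.
  rewrite mulrSr -[X in _ + X]opprK; apply: (Hsub) => //.
  by rewrite -sub0r; apply: (Hsub).
have HMz u (i : int) : H u -> H (u *~ i).
  move=> Hu; case: i => i; first by rewrite -pmulrn; apply: HMn.
  by rewrite NegzE mulrNz -pmulrn -sub0r; apply: (Hsub) => //; apply: HMn.
have Hd d : d \in D -> H d by move=> dD; apply: (ballH 1%N); apply: mem_ball1.
(* The representative of [u] modulo [z] that lies between [0] and [z]. *)
pose red (z u : R) := u - z *~ Num.floor (u / z).
have redP z u : 0 < z -> 0 <= red z u < z.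
  move=> z0; rewrite /red -mulrzr; have /andP[f1 f2] := floor_itv (u / z).
  move: f1 f2; rewrite ler_pdivlMr // ltr_pdivrMr // intrD mulrDl.
  by rewrite mulr1z mul1r [z * _]mulrC => *; apply/andP; split; lra.
have [r rP rmin] := exists_min x [seq red x w | w <- ball D t & 0 < red x w].
have [r0 Hr] : 0 < r /\ H r.
  move: rP; rewrite inE => /orP[/eqP->|]; first by split=> //; apply: Hd.
  move=> /mapP[w /[!mem_filter]/andP[w0 wt] ->]; split=> //.
  by apply: (Hsub); [apply: (ballH t)|apply: HMz; apply: Hd].
have {}rmin u : H u -> 0 < u -> r <= u.
  move=> Hu u0; have [xu|ux] := leP x u.
    by apply: le_trans xu; apply: rmin; rewrite mem_head.
  case: Hu => w wt uw; apply: rmin; rewrite inE; apply/orP; right.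
  have -> : u = red x w.
    apply: (congr_mod_small x0).
      by have /andP[? ?] := redP x w x0; apply/andP; split; lra.
    apply: congr_mod_trans uw _; exists (Num.floor (w / x)).
    by rewrite /red subrK.
  apply/map_f; rewrite mem_filter wt andbT.
  suff <- : u = red x w by [].
  apply: (congr_mod_small x0).
    by have /andP[? ?] := redP x w x0; apply/andP; split; lra.
  apply: congr_mod_trans uw _; exists (Num.floor (w / x)).
  by rewrite /red subrK.
have multiple u : H u -> 0 < u -> exists2 k, (0 < k)%N & u = r * k%:R.
  move=> Hu u0; have /andP[v0 vr] := redP r u r0.
  have E : red r u = 0.
    apply/eqP; rewrite eq_le v0 andbT leNgt; apply/negP => v0'.
    have : H (red r u) by apply: (Hsub) => //; apply: HMz.
    by move=> /rmin/(_ v0'); rewrite leNgt vr.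
  move: E => /eqP; rewrite subr_eq0 => /eqP.
  case: (Num.floor (u / r)) => k uE.
    exists k; last by rewrite uE -pmulrn mulr_natr.
    by case: k uE => // uE; move: u0; rewrite uE ltxx.
  move: u0; rewrite uE NegzE mulrNz oppr_gt0 -pmulrn pmulrn_llt0 //.
  by rewrite ltNge ltW.
have [q q0 xE] := multiple _ (Hd _ xD) x0.
exists r, q; split=> //; last first.
  move=> d dD; have /andP[d0 dx] := Dx _ dD.
  have [k k0 dE] := multiple _ (Hd _ dD) d0; exists k => //; rewrite k0 /=.
  by move: dx; rewrite dE xE ler_pM2l // ler_nat.
have /choice[f fP] : forall a : nat, exists w, w \in ball D t /\ congr_mod x (r *+ a) w.
  by move=> a; have [w wt ?] := HMn _ a Hr; exists w.
rewrite -[q](size_iota 0) -[X in (_ * X <= _)%N](size_iota 0).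
rewrite -(size_allpairs (fun a i => f a + x *+ i)).
apply: uniq_leq_size; last first.
  move=> _ /allpairsP[[a i] [_ /[!mem_iota] im ->]]; rewrite /= in im *.
  apply: mem_ballD; first by case: (fP a).
  by apply: leq_ball (ball_mulrn _ xD); lia.
apply: allpairs_uniq; rewrite ?iota_uniq // => u v.
move=> /allpairsP[[a i] [aq _ ->]] /allpairsP[[b j] [bq _ ->]] E.
rewrite /= in aq bq E *.
have ab : a = b.
  suff /(mulrIn (lt0r_neq0 r0)) : r *+ a = r *+ b by [].
  apply: (congr_mod_small x0).
    rewrite xE -(mulr_natr r a) -(mulr_natr r b) -mulrBr -mulrN !ltr_pM2l //.
    move: aq bq; rewrite !mem_iota -!(ltr_nat R) add0n => /andP[_ aq] /andP[_ bq].
    by have := ler0n R a; have := ler0n R b; move=> ? ?; apply/andP; split; lra.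
  apply: congr_mod_trans (proj2 (fP a)) _.
  apply: congr_mod_trans (congr_mod_sym (proj2 (fP b))).
  exists (j%:Z - i%:Z); rewrite mulrzBr -!pmulrn.
  by apply: (addIr (x *+ i)); rewrite E; ring.
by move: E; rewrite ab => /addrI/(mulrIn (lt0r_neq0 x0)) ->.
Qed.

Lemma card_subsums_catr (G : zmodType) (s t : seq G) :
  (#|` subsums t| <= #|` subsums (s ++ t)|)%N.
Proof.
elim: s => //= a s IH.
by apply: leq_trans IH _; rewrite card_subsums_cons leq_addr.
Qed.

Lemma exists_max (R : realDomainType) (x : R) (s : seq R) :
  exists2 r, r \in x :: s & forall u, u \in x :: s -> u <= r.
Proof.
have [r rs rmin] := exists_min (- x) (map -%R s).
exists (- r); first by rewrite -(mem_map oppr_inj) /= opprK.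
by move=> u us; rewrite lerNr; apply: rmin; rewrite -(mem_map oppr_inj) in us.
Qed.

Lemma leq_card_ball (G : zmodType) (D : seq G) (i j : nat) :
  (i <= j)%N -> (#|` ball D i| <= #|` ball D j|)%N.
Proof. by move=> ij; apply/fsubset_leq_card/fsubsetP => u; apply: leq_ball. Qed.

(** Greedily feed elements into half of [A] until every remaining element [d]
    has small [escape]. By subadditivity, all signed sums of a number of these
    [d] proportional to [size A] still have [escape] at most half the size of
    the set, hence there are only [O(size A ^ 2)] of them. Measured against the
    multiples of the largest remaining element, packing then forces the
    remaining elements to stabilise modulo it after boundedly many steps. *)
Lemma progression_core (R : realType) (C : nat) : (0 < C)%N ->
  exists M n1 : nat, forall A : seq R, (n1 <= size A)%N -> uniq A ->
  (forall a, a \in A -> 0 < a) -> (#|` subsums A| <= C * (size A) ^ 2)%N ->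
  exists D E r q, [/\ perm_eq A (D ++ E), (0 < size A <= 7 * size D)%N, 0 < r,
    (q <= M * size A)%N &
    forall d, d \in D -> exists2 k, (0 < k <= q)%N & d = r * k%:R].
Proof.
(* With [h] a quarter of [n = size A], rounded down, [n <= 7 * h], so that there
   are at most [c * h ^ 2] sums. The available radius [J] will be about [h / c],
   and [P + 1] disjoint blocks of [h * (h / (2 * c))] points are more than the
   [2 * c * h ^ 2] points of [ball F J]. *)
move=> C0; pose c := (49 * C)%N; pose P := (4 * c ^ 2)%N.
exists (4 * c ^ 2)%N, (4 * (2 * c * (1 + 3 * P) + 1))%N => A n1A Au Apos cardA.
set n := size A in n1A cardA *; pose h := (n %/ 4)%N.
have c0 : (0 < c)%N by rewrite /c; lia.
have hP : (2 * c * (1 + 3 * P) + 1 <= h)%N by rewrite /h leq_divRL // mulnC.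
have [n4h n7h] : (4 * h <= n)%N /\ (n <= 7 * h)%N.
  by rewrite /h; move: hP; rewrite /h; lia.
have cardA' : (#|` subsums A| <= c * h ^ 2)%N.
  apply: leq_trans cardA _; rewrite /c -mulnA -!mulnn.
  by have := leq_mul n7h n7h; nia.
pose B0 := drop (2 * h) A; pose D0 := take (2 * h) A.
have sD0 : size D0 = (2 * h)%N by rewrite size_take -/n; case: ifP => //; lia.
have sB0 : (2 * h <= size B0)%N by rewrite size_drop -/n; lia.
have [|E [F [DEF [Eh H]]]] := @greedy_small_escape _ B0 D0 h (c * h).
  by rewrite sD0; lia.
have AEF : perm_eq A (F ++ (E ++ B0)).
  rewrite -[A](cat_take_drop (2 * h)) -/D0 -/B0 catA perm_cat2r.
  by apply: perm_trans DEF _; rewrite perm_catC.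
have cardX : (#|` subsums (E ++ B0)| <= c * h ^ 2)%N.
  apply: leq_trans cardA'; rewrite (perm_subsums AEF).
  exact: card_subsums_catr.
case: H => [escF|[]]; last first.
  move=> H _; have := leq_trans H cardX; rewrite mulnS -mulnn mulnCA; lia.
have [Fu EBu] : uniq F /\ uniq (E ++ B0).
  by move: Au; rewrite (perm_uniq AEF) (cat_uniq F); case/and3P.
have cardX' : (2 * h ^ 2 <= #|` subsums (E ++ B0)|)%N.
  apply: leq_trans (card_subsums_ge EBu _); last first.
    by move=> x xEB; apply: Apos; rewrite (perm_mem AEF) mem_cat xEB orbT.
  have /(leq_bin2l 2) : (2 * h + 1 <= (size (E ++ B0)).+1)%N.
    by rewrite size_cat addn1 ltnS (leq_trans sB0) ?leq_addl.
  move=> binEB; apply: leq_trans (leq_addr 1 _); apply: leq_trans binEB.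
  by rewrite bin2 addn1 geq_half_double -mulnn -muln2 /=; lia.
have sF : (h <= size F <= 2 * h)%N.
  by move: (perm_size DEF); rewrite size_cat sD0; lia.
have [x xF xmax] : exists2 x, x \in F & forall u, u \in F -> u <= x.
  by move: sF; case: {+}F => [|y s] /= sF; [lia|apply: exists_max].
have Fx d : d \in F -> 0 < d <= x.
  by move=> dF; rewrite xmax // andbT Apos // (perm_mem AEF) mem_cat dF.
pose J := (h %/ c)%N; pose m := (J - 3 * P - 1)%N.
have Jc : (J * c <= h)%N by apply: leq_trunc_div.
have Jc' : (h < J.+1 * c)%N by rewrite ltn_ceil.
have JP : (3 * P < J)%N by rewrite leq_divRL //; nia.
have mE : (3 * P + 1 + m = J)%N by rewrite /m; lia.
have hm : (h <= 2 * c * m.+1)%N.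
  have -> : m.+1 = (J - 3 * P)%N by rewrite /m; lia.
  by rewrite mulnBr; nia.
have ballJ : (#|` ball F J| <= 2 * (c * h ^ 2))%N.
  apply: leq_trans (_ : _ <= 2 * #|` subsums (E ++ B0)|)%N _; last by lia.
  apply: card_small_escape; first exact: subsums_nonempty.
  move=> y /(escape_ball escF) yJ; apply: leq_trans _ cardX'.
  rewrite leq_mul2l /= -mulnn; apply: leq_trans yJ _.
  by rewrite mulnA leq_mul2r Jc orbT.
have [i iP stable] : exists2 i, (i < P)%N &
    forall g, g \in ball F (3 * i + 3) ->
    exists2 w, w \in ball F (3 * i + 2) & congr_mod x g w.
  apply: contrapT => H.
  have := @packing _ F x P m Fu Fx xF; rewrite mE => /(_ _)/wrap[].
    move=> i iP; apply: contrapT => H1; apply: H; exists i => // g gi.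
    apply: contrapT => H2; apply: H1; exists g => // w wi gw; apply: H2.
    by exists w.
  move=> H1; have {}H1 := leq_trans H1 ballJ.
  have H2 : (P.+1 * (h * h) <= 2 * c * (P.+1 * (size F * m.+1)))%N.
    rewrite [leqRHS]mulnCA leq_mul2l [(2 * c * _)%N]mulnCA; apply/orP; right.
    by case/andP: sF => hF _; apply: leq_mul.
  have {H1}H3 : (2 * c * (P.+1 * (size F * m.+1)) <= 2 * c * (2 * (c * h ^ 2)))%N.
    by rewrite leq_mul2l H1 orbT.
  have h0 : (0 < h * h)%N by rewrite muln_gt0; lia.
  by have := leq_trans H2 H3; rewrite /P -!mulnn; lia.
have [|r [q [r0 qm rq]]] := @progression_of_stable _ F x (3 * i + 2) m Fx xF.
  by move=> g; rewrite -addnS; apply: stable.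
exists F, (E ++ B0), r, q; split=> //.
  case/andP: sF => hF _; rewrite (leq_trans n7h) ?leq_mul2l // andbT.
  by apply: leq_trans n4h; rewrite muln_gt0; lia.
have : (q * m.+1 <= 2 * (c * h ^ 2))%N.
  by apply: leq_trans qm (leq_trans (leq_card_ball _ _) ballJ); lia.
rewrite -(@leq_pmul2l (2 * c)) ?muln_gt0 // => H.
have : (q * h <= 4 * c ^ 2 * h * h)%N.
  apply: (@leq_trans (q * (2 * c * m.+1))); first by rewrite leq_mul2l hm orbT.
  by move: H; rewrite -!mulnn; lia.
rewrite leq_pmul2r; last by lia.
by move=> H'; apply: leq_trans H' _; rewrite leq_mul2l; lia.
Qed.

(** * Adjoining elements incommensurable with a progression *)

Definition separated (G : zmodType) (U : {fset G}) (y : G) (Q : nat) :=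
  forall u v q, u \in U -> v \in U -> (0 < q <= Q)%N -> v <> u + y *+ q.

(** Follow the progression [u, u + y, ...] from each point [u] of [U] to its
    last consecutive term in [X]: these last terms escape, and they are distinct
    since otherwise two points of [U] would differ by a short multiple of [y]. *)
Lemma escape_ge_chains (G : zmodType) (X U : {fset G}) (y : G) (Q : nat) :
  separated U y Q -> U `<=` X ->
  (forall z, z \in X -> exists2 q, (q <= Q)%N & z + y *+ q \notin X) ->
  (#|` U| <= escape X y)%N.
Proof.
move=> sepU /fsubsetP UX exitX.
have /choice[f fP] : forall u : G, exists q : nat, u \in U ->
    [/\ (q < Q)%N, u + y *+ q \in X & u + y *+ q.+1 \notin X].
  move=> u; have [uU|] := boolP (u \in U); last by exists 0%N.
  have exq : exists q, u + y *+ q \notin X.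
    by have [q _ ?] := exitX _ (UX _ uU); exists q.
  case: (ex_minnP exq) => -[|q] qX qmin.
    by move: qX; rewrite mulr0n addr0 UX.
  exists q => _; split=> //.
    have [q' q'Q /qmin] := exitX _ (UX _ uU); lia.
  by apply: contraT => /qmin; rewrite ltnn.
apply: (@leq_card_fset_inj _ _ _ _ (fun u => u + y *+ f u)).
  have H u v : u \in U -> v \in U -> (f u < f v)%N ->
      u + y *+ f u <> v + y *+ f v.
    move=> uU vU fuv E; have [fvQ _ _] := fP _ vU.
    apply: (sepU v u (f v - f u)%N) => //; first by lia.
    by apply: (addIr (y *+ f u)); rewrite E -addrA -mulrnDr subnK // ltnW.
  move=> u v uU vU E; have [/(H _ _ uU vU)//|/(H _ _ vU uU) H'|fuv] := ltngtP (f u) (f v).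
    by case: H'.
  by apply: (addIr (y *+ f u)); rewrite E fuv.
move=> u uU; have [_ uX uX'] := fP _ uU.
by rewrite !inE uX -addrA -mulrSr.
Qed.

(** Of more than [#|` S|] consecutive terms of a progression of difference [y]
    inside [sumset S T], two lie in the same translate of [T]. *)
Lemma sumset_exit (G : zmodType) (S T : {fset G}) (y : G) (Q : nat) :
  separated T y Q -> (#|` S| <= Q)%N ->
  forall z, z \in sumset S T ->
  exists2 q, (q <= Q)%N & z + y *+ q \notin sumset S T.
Proof.
move=> sepT SQ z zX; apply: contrapT => H.
have inX q : (q <= Q)%N -> z + y *+ q \in sumset S T.
  by move=> qQ; apply: contraT => qX; case: H; exists q.
have /choice[f fP] : forall q : nat, exists a : G, (q <= Q)%N ->
    a \in S /\ exists2 t, t \in T & z + y *+ q = a + t.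
  move=> q; have [/inX/sumsetP[a [t [aS tT E]]]|] := leqP q Q.
    by exists a => _; split=> //; exists t.
  by exists 0.
have : ~~ uniq [seq f q | q <- iota 0 Q.+1].
  apply/negP => fu.
  have /(uniq_leq_size fu) : {subset [seq f q | q <- iota 0 Q.+1] <= S}.
    by move=> a /mapP[q /[!mem_iota] qQ ->]; have [] := fP q; first by lia.
  by rewrite size_map size_iota => /leq_trans/(_ SQ); rewrite ltnn.
move=> /(uniqPn 0)[i [j [ij]]]; rewrite size_map size_iota => jQ.
rewrite !(nth_map 0%N) ?size_iota ?nth_iota ?add0n //; try lia.
move=> E.
have [|_ [t tT Et]] := fP i; first by lia.
have [|_ [t' t'T Et']] := fP j; first by lia.
apply: (sepT t t' (j - i)%N) => //; first by lia.
apply: (addrI (f j)); rewrite -Et' -{1}E addrA -Et -addrA -mulrnDr subnKC //.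
exact: ltnW.
Qed.

Lemma escape_ge_separated (G : zmodType) (S T U : {fset G}) (y : G) (Q : nat) :
  separated T y Q -> (#|` S| <= Q)%N -> separated U y Q ->
  U `<=` sumset S T -> (#|` U| <= escape (sumset S T) y)%N.
Proof.
by move=> sepT SQ sepU UX; apply: escape_ge_chains sepU UX (sumset_exit sepT SQ).
Qed.

Lemma card_subsums_le (G : zmodType) (s : seq G) :
  (#|` subsums s| <= 2 ^ size s)%N.
Proof.
elim: s => [|a s IH]; first by rewrite subsums_nil cardfs1.
rewrite card_subsums_cons /= expnS mul2n -addnn; apply: leq_add => //.
by apply: leq_trans IH; apply/fsubset_leq_card/fsubsetP => z /[!inE]/andP[].
Qed.

Lemma sub_sumset_subsums (G : zmodType) (s : seq G) (T : {fset G}) :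
  T `<=` sumset (subsums s) T.
Proof.
apply/fsubsetP => t tT; rewrite -[t]add0r; apply: mem_sumset => //.
exact: subsums0.
Qed.

Lemma card_sumset_cons (G : zmodType) (y : G) (s : seq G) (T : {fset G}) :
  #|` sumset (subsums (y :: s)) T| =
  (#|` sumset (subsums s) T| + escape (sumset (subsums s) T) y)%N.
Proof. by rewrite subsums_cons -sumsetA card_sumset_pair. Qed.

Lemma card_sumset_separated (G : zmodType) (T : {fset G}) (s : seq G) (Q : nat) :
  (2 ^ size s <= Q)%N -> (forall y, y \in s -> separated T y Q) ->
  ((size s).+1 * #|` T| <= #|` sumset (subsums s) T|)%N.
Proof.
elim: s => [|y s IH] /= sQ sep.
  by rewrite mul1n subsums_nil sumset0.
have sQ' : (2 ^ size s <= Q)%N by apply: leq_trans sQ; rewrite leq_exp2l.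
rewrite card_sumset_cons mulSn addnC; apply: leq_add.
  by apply: IH => // z zs; apply: sep; rewrite inE zs orbT.
have sepy : separated T y Q by apply: sep; rewrite mem_head.
apply: (escape_ge_separated sepy) (sub_sumset_subsums _ _) => //.
exact: leq_trans (card_subsums_le _) sQ'.
Qed.

Definition small_multiple (R : realDomainType) (r : R) (N : nat) (z : R) :=
  exists2 k : int, (`|k| <= N)%N & z = r * k%:~R.

(** The elements that resist absorption: no refinement of the ratio by a factor at
    most [Q] brings them into the range [N] of the progression. *)
Definition far (R : realDomainType) (r : R) (N Q : nat) (y : R) :=
  forall q, (0 < q <= Q)%N -> ~ small_multiple r N (y *+ q).

(** Bounding the total rather than each term confines all the subset sums to the
    first [N] multiples of [r]. *)
Definition progression (R : realDomainType) (r : R) (N : nat) (s : seq R) :=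
  (forall a, a \in s -> exists2 k, (0 < k)%N & a = r * k%:R) /\
  \sum_(a <- s) a <= r * N%:R.

Lemma subsums_progression (R : realDomainType) (r : R) (N : nat) (s : seq R) (t : R) :
  0 < r -> progression r N s -> t \in subsums s ->
  exists2 k, (k <= N)%N & t = r * k%:R.
Proof.
move=> r0 [sP sN] /subsumsP[v vs ->].
have [k kE] : exists k, \sum_(a <- v) a = r * k%:R.
  have : forall a, a \in v -> exists2 k, (0 < k)%N & a = r * k%:R.
    by move=> a av; apply: sP; apply: (mem_subseq vs).
  elim: v {vs} => [|a v IH] vP; first by exists 0%N; rewrite big_nil mulr0.
  have [|k kE] := IH; first by move=> b bv; apply: vP; rewrite inE bv orbT.
  have [k' _ k'E] := vP a (mem_head _ _).
  by exists (k' + k)%N; rewrite big_cons kE k'E natrD mulrDr.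
exists k => //; rewrite -(ler_nat R) -(ler_pM2l r0) -kE.
apply: le_trans sN; apply: ler_sum_subseq vs => a /sP[i i0 ->].
by rewrite mulr_ge0 ?ler0n // ltW.
Qed.

Lemma progression_subsumsB (R : realDomainType) (r : R) (N : nat) (s : seq R) (t t' : R) :
  0 < r -> progression r N s -> t \in subsums s -> t' \in subsums s ->
  small_multiple r N (t - t').
Proof.
move=> r0 sP /(subsums_progression r0 sP)[k kN ->].
move=> /(subsums_progression r0 sP)[k' k'N ->].
exists (k%:Z - k'%:Z); first by lia.
by rewrite -mulrBr intrD intrN.
Qed.

Lemma progression_separated (R : realDomainType) (r : R) (N Q : nat) (s : seq R) (y : R) :
  0 < r -> progression r N s -> far r N Q y -> separated (subsums s) y Q.
Proof.
move=> r0 sP yfar u v q us vs qQ E; apply: (yfar q qQ).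
have -> : y *+ q = v - u by rewrite E addrC addKr.
exact: progression_subsumsB sP _ _.
Qed.

(** Feed in the elements of [z], starting a new translate of [T] each time their
    running total passes a further multiple of [2 * M]: these translates are
    disjoint, as a single element overshoots that multiple by at most [M]. *)
Lemma sum_bound (R : realDomainType) (T : {fset R}) (M : R) (z : seq R) :
  0 < M -> (forall t, t \in T -> 0 <= t <= M) ->
  (forall a, a \in z -> a <= M) ->
  exists2 c : nat, (c * #|` T| <= #|` sumset (subsums z) T|)%N &
    \sum_(a <- z) a < 2 * M * c%:R.
Proof.
move=> M0 TM zM.
suff [c [W [WX cW Wlt zlt]]] : exists (c : nat) (W : {fset R}),
    [/\ W `<=` sumset (subsums z) T, (c * #|` T| <= #|` W|)%N,
        forall w, w \in W -> w < 2 * M * c%:R & \sum_(a <- z) a < 2 * M * c%:R].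
  by exists c => //; apply: leq_trans cW _; apply: fsubset_leq_card.
elim: z zM => [|a z IH] zM.
  exists 1%N, T; rewrite subsums_nil sumset0 big_nil mul1n mulr1; split=> //.
    by move=> t /TM; lra.
  by lra.
have [|c [W [WX cW Wlt zlt]]] := IH; first by move=> b bz; apply: zM; rewrite inE bz orbT.
have aM := zM a (mem_head _ _).
have WX' : W `<=` sumset (subsums (a :: z)) T.
  apply: fsubset_trans WX _; apply: sumset_fsub; apply/fsubsetP => u uz.
  by rewrite subsums_cons -[u]add0r; apply: mem_sumset => //; rewrite !inE eqxx.
have [zc|zc] := ltP (\sum_(b <- a :: z) b) (2 * M * c%:R).
  by exists c, W.
have cS : 2 * M * c.+1%:R = 2 * M * c%:R + (M + M).
  by rewrite -[c.+1]addn1 natrD mulrDr mulr1 mulr_natl mulr2n.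
exists c.+1, (W `|` [fset \sum_(b <- a :: z) b + t | t in T]); split.
- rewrite fsubUset WX' /=; apply/fsubsetP => _ /imfsetP[t tT ->].
  by apply: mem_sumset => //; apply: mem_subsums.
- rewrite cardfsU disjoint_fsetI0 ?cardfs0 ?subn0.
    rewrite card_imfset /=; last by move=> ? ? /addrI.
    by rewrite mulSn addnC leq_add2r.
  apply/fdisjointP => w /Wlt wc; apply/negP => /imfsetP[t /TM/andP[t0 _] E].
  by move: wc; rewrite E /= ltNge (le_trans zc) ?lerDl.
- move=> w; rewrite in_fsetU => /orP[/Wlt wc|/imfsetP[t /TM/andP[_ tM] ->]].
    by rewrite cS (lt_trans wc) // ltrDl addr_gt0.
  rewrite cS big_cons addrA; apply: ltr_leD => //.
  by rewrite [a + _]addrC; apply: ltr_leD.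
rewrite cS big_cons [a + _]addrC; apply: ltr_leD => //.
by rewrite (le_trans aM) ?lerDl ?ltW.
Qed.

Lemma small_multiple_nat (R : realDomainType) (r z : R) (N : nat) :
  0 < r -> 0 < z -> small_multiple r N z -> exists2 k, (0 < k <= N)%N & z = r * k%:R.
Proof.
move=> r0 z0 [[k|k] kN zE].
  exists k => //; rewrite kN andbT lt0n; apply: contraTneq z0 => k0.
  by rewrite zE k0 mulr0 ltxx.
by move: z0; rewrite zE pmulr_rgt0 // ltr0z.
Qed.

Lemma double_bin2 (n : nat) : (2 * 'C(n.+1, 2) = n.+1 * n)%N.
Proof. by elim: n => // n IH; rewrite binS bin1 mulnDr IH; lia. Qed.

(** [Q`!] is a common denominator for all the possible multipliers of [y]: one
    refinement of the ratio serves for all the elements that are not far. *)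
Lemma progression_refine (R : realFieldType) (r : R) (N Q : nat) (y : R) :
  0 < r -> 0 < y -> ~ far r N Q y ->
  exists2 k, (0 < k)%N & y = r / Q`!%:R * k%:R /\ y <= r * N%:R.
Proof.
move=> r0 y0 /existsNP[q /not_implyP[/andP[q0 qQ] /contrapT yq]].
have yq0 : 0 < y *+ q by rewrite pmulrn_lgt0.
have [k /andP[k0 kN] yE] := small_multiple_nat r0 yq0 yq.
have /dvdnP[d dE] : (q %| Q`!)%N by apply: dvdn_fact; rewrite q0.
have d0 : (0 < d)%N by have := fact_gt0 Q; rewrite dE muln_gt0 => /andP[].
have qn0 : q%:R != 0 :> R by rewrite pnatr_eq0 -lt0n.
have dn0 : d%:R != 0 :> R by rewrite pnatr_eq0 -lt0n.
exists (d * k)%N; first by rewrite muln_gt0 d0.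
have yE' : y = r * k%:R / q%:R by rewrite -yE -(mulr_natr y q) mulfK.
split; first by rewrite dE !natrM yE'; field; rewrite qn0 dn0.
apply: le_trans (_ : y *+ q <= _).
  by rewrite -mulr_natr ler_peMr ?ler1n // ltW.
by rewrite yE ler_pM2l // ler_nat.
Qed.

Lemma far_separated_count (R : realDomainType) (r : R) (N Q : nat) (A1 s A' : seq R) :
  0 < r -> progression r N A1 -> (2 ^ size s <= Q)%N ->
  (forall y, y \in s -> far r N Q y) ->
  ((size s).+1 * #|` subsums A1| <= #|` subsums (A' ++ s ++ A1)|)%N.
Proof.
move=> r0 A1P sQ sfar; apply: leq_trans (card_subsums_catr _ _).
rewrite subsums_cat; apply: card_sumset_separated sQ _ => y /sfar yfar.
exact: progression_separated A1P yfar.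
Qed.

(** The subset sums [T] of the core have size comparable to [n ^ 2]. So only
    boundedly many elements are far from the core, each of them adding at least
    [#|` T|] sums; and the elements near it have total [O(n ^ 2)], since
    otherwise they carry [T] to too many disjoint translates. *)
Lemma progression_up_to_bounded (R : realType) (C : nat) : (0 < C)%N ->
  exists K s n1 : nat, forall A : seq R, (n1 <= size A)%N -> uniq A ->
  (forall a, a \in A -> 0 < a) -> (#|` subsums A| <= C * (size A) ^ 2)%N ->
  exists A1 A2 r, [/\ perm_eq A (A1 ++ A2), 0 < r, (size A2 <= s)%N &
    progression r (K * size A ^ 2) A1].
Proof.
move=> C0; have [M [n1 core]] := progression_core R C0.
(* [n <= 7 * size D] and [size D ^ 2 <= 2 * #|T|] bound [n ^ 2] by [98 * #|T|]. *)
pose s := (98 * C)%N; pose Q := (2 ^ s.+1)%N.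
exists (Q`! * (2 * s + 1) * M)%N, s, n1 => A nA Au Apos cardA.
have [D [E [r [q [AE /andP[n0 n7D] r0 qM Dq]]]]] := core A nA Au Apos cardA.
have [Du Eu] : uniq D /\ uniq E.
  by move: Au; rewrite (perm_uniq AE) cat_uniq; case/and3P.
have Dpos d : d \in D -> 0 < d.
  by move=> dD; apply: Apos; rewrite (perm_mem AE) mem_cat dD.
have Epos e : e \in E -> 0 < e.
  by move=> eE; apply: Apos; rewrite (perm_mem AE) mem_cat eE orbT.
set n := size A in n0 n7D qM cardA *.
pose T := subsums D; pose N := (q * size D)%N.
have cardT : (#|` subsums A| <= s * #|` T|)%N.
  apply: leq_trans cardA _; rewrite /s [(98 * _)%N]mulnC -mulnA leq_mul2l.
  apply/orP; right; apply: (@leq_trans (49 * (size D * size D))).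
    by rewrite -mulnn; have := leq_mul n7D n7D; lia.
  have := card_subsums_ge Du Dpos; have := double_bin2 (size D).
  rewrite -/T; move: (#|` T|) (size D) 'C(_, _) => c d b; nia.
have T0 : (0 < #|` T|)%N by apply: subsums_nonempty.
have DP : progression r N D.
  split; first by move=> d /Dq[k /andP[k0 _] ->]; exists k.
  rewrite /N natrM mulrA big_seq.
  apply: le_trans (_ : \sum_(d <- D | d \in D) (r * q%:R) <= _).
    by apply: ler_sum => d /Dq[k /andP[_ kq] ->]; rewrite ler_pM2l // ler_nat.
  by rewrite -big_seq big_const_seq count_predT iter_addr_0 -[leLHS]mulr_natr mulr_natr.
pose F := [seq y <- E | `[< far r N Q y >]].
pose G := [seq y <- E | ~~ `[< far r N Q y >]].
have EFG : perm_eq E (G ++ F).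
  by rewrite perm_sym perm_catC; apply/permPl/perm_filterC.
exists (D ++ G), F, (r / Q`!%:R); split.
- by apply: perm_trans AE _; rewrite -catA perm_cat2l.
- by rewrite divr_gt0 // ltr0n fact_gt0.
- rewrite leqNgt; apply/negP => sF.
  have sizeF : size (take s.+1 F) = s.+1 by rewrite size_takel.
  have farF y : y \in take s.+1 F -> far r N Q y.
    by move=> /mem_take; rewrite mem_filter => /andP[/asboolP].
  have sQ : (2 ^ size (take s.+1 F) <= Q)%N by rewrite sizeF.
  have := far_separated_count (G ++ drop s.+1 F) r0 DP sQ farF; rewrite sizeF.
  rewrite (_ : subsums (_ ++ _) = subsums A); last first.
    apply: perm_subsums; apply/permP => a; rewrite (permP AE) !count_cat.
    rewrite (permP EFG) count_cat -[in RHS](cat_take_drop s.+1 F) count_cat.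
    by move: (count a D) (count a G) (count a (take _ F)) (count a (drop _ F)); lia.
  move=> H; have := leq_trans H cardT; rewrite leq_pmul2r //; lia.
have Gle y : y \in G -> exists2 k, (0 < k)%N & y = r / Q`!%:R * k%:R /\ y <= r * N%:R.
  rewrite mem_filter => /andP[/asboolPn yfar yE].
  by apply: progression_refine => //; apply: Epos.
split.
  move=> a; rewrite mem_cat => /orP[/Dq[k /andP[k0 _] ->]|]; last first.
    by move=> /Gle[k k0 [yE _]]; exists k.
  exists (Q`! * k)%N; first by rewrite muln_gt0 fact_gt0.
  by rewrite natrM mulrA divfK // pnatr_eq0 -lt0n fact_gt0.
have N0 : (0 < N)%N.
  have D0 : (0 < size D)%N by lia.
  rewrite muln_gt0 D0 andbT; move: Dq; case: {+}D D0 => // d D' _ /(_ d (mem_head _ _)).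
  by case=> k; lia.
have NMn : (N <= M * n ^ 2)%N.
  rewrite /N -mulnn mulnA leq_mul // /n (perm_size AE) size_cat leq_addr //.
have [|t|y|c cT sG] := @sum_bound _ T (r * N%:R) G.
- by rewrite mulr_gt0 // ltr0n.
- move=> /(subsums_progression r0 DP)[k kN ->].
  by rewrite mulr_ge0 ?ler0n ?(ltW r0) //= ler_pM2l // ler_nat.
- by move=> /Gle[k _ []].
have cs : (c <= s)%N.
  rewrite -(leq_pmul2r T0); apply: leq_trans cT (leq_trans _ cardT).
  rewrite -subsums_cat (_ : subsums A = subsums (F ++ (G ++ D))) ?card_subsums_catr //.
  apply: perm_subsums; apply/permP => a; rewrite (permP AE) !count_cat.
  by rewrite (permP EFG) count_cat addnCA [in RHS]addnC addnA addnAC.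
rewrite big_cat /=; apply: le_trans (_ : r * N%:R * (2 * s + 1)%:R <= _).
  rewrite natrD natrM mulrDr mulr1 addrC; apply: lerD; last exact: (proj2 DP).
  apply: le_trans (ltW sG) _; rewrite mulrA [_ * 2]mulrC ler_wpM2l ?ler_nat //.
  by rewrite !mulr_ge0 ?ler0n // ltW.
have Q0 : Q`!%:R != 0 :> R by rewrite pnatr_eq0 -lt0n fact_gt0.
rewrite !natrM [leRHS](_ : _ = r * ((2 * s + 1)%:R * (M%:R * (n ^ 2)%:R))); last first.
  by rewrite -!mulrA [Q`!%:R * _]mulrA -!mulrA; field.
by rewrite -mulrA ler_pM2l // [leLHS]mulrC ler_wpM2l ?ler0n // -!natrM ler_nat.
Qed.

(** * The exact count *)

Lemma small_multiple0 (R : realDomainType) (r : R) (N : nat) : small_multiple r N 0.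
Proof. by exists 0 => //; rewrite mulr0. Qed.

Lemma small_multipleW (R : realDomainType) (r z : R) (N N' : nat) :
  (N <= N')%N -> small_multiple r N z -> small_multiple r N' z.
Proof. by move=> NN' [k kN ->]; exists k => //; apply: leq_trans NN'. Qed.

Lemma small_multipleD (R : realDomainType) (r z z' : R) (N N' : nat) :
  small_multiple r N z -> small_multiple r N' z' -> small_multiple r (N + N') (z + z').
Proof.
move=> [k kN ->] [k' k'N ->]; exists (k + k'); first by lia.
by rewrite intrD mulrDr.
Qed.

Lemma small_multipleN (R : realDomainType) (r z : R) (N : nat) :
  small_multiple r N z -> small_multiple r N (- z).
Proof. by move=> [k kN ->]; exists (- k); [lia|rewrite intrN mulrN]. Qed.

Lemma small_multipleMz (R : realDomainType) (r z : R) (N Q : nat) (q : int) :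
  (`|q| <= Q)%N -> small_multiple r N z -> small_multiple r (Q * N) (z *~ q).
Proof.
move=> qQ [k kN ->]; exists (k * q).
  by rewrite abszM mulnC leq_mul.
by rewrite intrM mulrA [RHS]mulrzr.
Qed.

Lemma farW (R : realDomainType) (r y : R) (N N' Q Q' : nat) :
  (N <= N')%N -> (Q <= Q')%N -> far r N' Q' y -> far r N Q y.
Proof.
move=> NN' QQ' yfar q /andP[q0 qQ] yq; apply: (yfar q).
  by rewrite q0 (leq_trans qQ).
exact: small_multipleW yq.
Qed.

Definition independent (R : realDomainType) (r : R) (N Q : nat) (y1 y2 : R) :=
  forall q : int, (`|q| <= Q)%N -> ~ small_multiple r N (y1 - y2 *~ q).

(** If [y1] were a multiple [q] of [y2] and [y2] a multiple [q'] of [y1], up to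
    small errors, then [1 - q * q'] would be a multiplier making [y1] small,
    unless [q] and [q'] are both [1] or both [-1]. *)
Lemma independent_or (R : realDomainType) (r : R) (N Q : nat) (y1 y2 : R) :
  far r (Q.+1 * N) (Q * Q).+1 y1 ->
  ~ small_multiple r N (y1 - y2) -> ~ small_multiple r N (y1 + y2) ->
  independent r N Q y1 y2 \/ independent r N Q y2 y1.
Proof.
move=> far1 sub12 add12; apply: contrapT => /not_orP[].
move=> /existsNP[q /not_implyP[qQ /contrapT e]].
move=> /existsNP[q' /not_implyP[q'Q /contrapT e']].
have E : y1 *~ (1 - q * q') = (y2 - y1 *~ q') *~ q + (y1 - y2 *~ q).
  rewrite mulrzBr mulr1z [q * _]mulrC mulrzA mulrzBl.
  by move: (y2 *~ q) (y1 *~ q' *~ q) => a b; ring.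
have sE : small_multiple r (Q.+1 * N) (y1 *~ (1 - q * q')).
  rewrite E mulSn addnC; apply: small_multipleD => //; exact: small_multipleMz.
have [d0|d0] := eqVneq (1 - q * q') 0.
  have /eqP : (`|q| * `|q'| = 1)%N by rewrite -abszM; lia.
  rewrite muln_eq1 => /andP[/eqP absq _].
  have [q1|q1] : q = 1 \/ q = -1 by lia.
    by apply: sub12; move: e; rewrite q1 mulr1z.
  by apply: add12; move: e; rewrite q1 mulrN1z opprK.
have qq' : (`|(q * q')%R| <= Q * Q)%N by rewrite abszM leq_mul.
apply: (far1 (absz (1 - q * q')%R)); first by lia.
case: (1 - q * q') sE => k; first by rewrite -pmulrn.
by rewrite NegzE mulrNz -pmulrn => /small_multipleN; rewrite opprK.
Qed.

(** Adjoining [y2] after [y1] adds the chains of both [T] and [y1 + T]. *)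
Lemma card_independent (R : realDomainType) (r : R) (N Q : nat) (A1 s : seq R)
    (y1 y2 : R) :
  0 < r -> progression r N A1 -> (2 ^ (size s).+1 <= Q)%N ->
  (forall y, y \in [:: y2, y1 & s] -> far r N Q y) -> independent r N Q y1 y2 ->
  ((size s).+4 * #|` subsums A1| <= #|` sumset (subsums [:: y2, y1 & s]) (subsums A1)|)%N.
Proof.
move=> r0 A1P sQ sfar ind; set T := subsums A1.
have smallT t t' : t \in T -> t' \in T -> small_multiple r N (t - t').
  exact: progression_subsumsB A1P.
have sep y : y \in [:: y2, y1 & s] -> separated T y Q.
  by move=> /sfar; apply: progression_separated A1P.
have Q0 : (0 < Q)%N by apply: leq_trans sQ; rewrite expn_gt0.
pose U := T `|` [fset y1 + t | t in T].
have cU : #|` U| = (2 * #|` T|)%N.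
  rewrite cardfsU disjoint_fsetI0 ?cardfs0 ?subn0.
    by rewrite card_imfset /= ?mul2n ?addnn // => ? ? /addrI.
  apply/fdisjointP => t tT; apply/negP => /imfsetP[t' t'T E].
  apply: (sfar y1 _ 1%N); rewrite ?inE ?eqxx ?orbT //.
  by rewrite mulr1n; have <- : t - t' = y1; [rewrite E addrK|exact: smallT].
have X1 : ((size s).+2 * #|` T| <= #|` sumset (subsums (y1 :: s)) T|)%N.
  apply: (@card_sumset_separated _ T (y1 :: s) Q sQ) => y ys.
  by apply: sep; rewrite inE ys orbT.
suff X2 : (2 * #|` T| <= escape (sumset (subsums (y1 :: s)) T) y2)%N.
  by rewrite card_sumset_cons; have := leq_add X1 X2; rewrite -mulnDl addn2.
rewrite -cU; apply: (escape_ge_separated (sep _ (mem_head _ _))).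
- exact: leq_trans (card_subsums_le (y1 :: s)) sQ.
- have y2far := sfar _ (mem_head _ _).
  move=> u v q; rewrite /U !in_fsetU.
  move=> /orP[uT|/imfsetP[t tT ->]] /orP[vT|/imfsetP[t' t'T ->]] qQ E.
  + by apply: (sep y2 (mem_head _ _) u v q).
  + apply: (ind q%:Z) => //; first by lia.
    rewrite -pmulrn (_ : _ - _ = u - t'); last by rewrite -[u](addrK (y2 *+ q)) -E; ring.
    exact: smallT.
  + apply: (ind (- q%:Z)) => //; first by lia.
    rewrite mulrNz opprK -pmulrn (_ : _ + _ = v - t); last by rewrite E; ring.
    exact: smallT.
  by apply: (sep y2 (mem_head _ _) t t' q) => //; apply: (addrI y1); rewrite E addrA.
rewrite /U fsubUset sub_sumset_subsums /=; apply/fsubsetP => _ /imfsetP[t tT ->].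
apply: mem_sumset => //; rewrite subsums_cons -[X in X \in _]addr0.
by apply: mem_sumset; [rewrite !inE eqxx orbT|exact: subsums0].
Qed.

Lemma ler_sum_take (R : realDomainType) (us v : seq R) :
  sorted >=%R us -> subseq v us ->
  \sum_(x <- v) x <= \sum_(x <- take (size v) us) x.
Proof.
elim: us v => [|b us IH] v; first by rewrite subseq0 => _ /eqP->.
move=> /= sb; have us_sorted := path_sorted sb.
case: v => [|a v] /=; first by rewrite !big_nil.
have [-> vs|_ vs] := eqVneq a b.
  by rewrite !big_cons lerD2l IH.
apply: le_trans (IH _ us_sorted vs) _.
have sv : (size v < size us)%N by have := size_subseq vs.
rewrite /= (take_nth 0 sv) -cats1 big_cat /= big_seq1 big_cons addrC lerD2r.
exact/(ge_path_max sb)/mem_nth.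
Qed.

Lemma small_multiple_sum (R : realDomainType) (r y0 : R) (N : nat) (v : seq R) :
  (forall u, u \in v -> small_multiple r N (u - y0)) ->
  small_multiple r (size v * N) (\sum_(u <- v) u - y0 *+ size v).
Proof.
elim: v => [|u v IH] vP.
  by rewrite big_nil subr0; apply: small_multiple0.
rewrite big_cons mulSn mulrS opprD addrACA; apply: small_multipleD.
  by apply: vP; rewrite mem_head.
by apply: IH => w wv; apply: vP; rewrite inE wv orbT.
Qed.

(** A sum of [k] elements congruent to [y0] determines [k], because no short
    multiple of the far element [y0] is small. *)
Lemma class_unique (R : realDomainType) (r y0 w : R) (N Q k k' : nat) :
  far r (N + N) Q y0 -> (k <= Q)%N -> (k' <= Q)%N ->
  small_multiple r N (w - y0 *+ k) -> small_multiple r N (w - y0 *+ k') -> k = k'.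
Proof.
move=> y0far kQ k'Q.
have H i j : (i <= Q)%N -> (j < i)%N ->
    small_multiple r N (w - y0 *+ i) -> small_multiple r N (w - y0 *+ j) -> False.
  move=> iQ ji wi wj; apply: (y0far (i - j)%N); first by lia.
  rewrite (_ : y0 *+ (i - j) = (w - y0 *+ j) - (w - y0 *+ i)).
    by apply: small_multipleD => //; apply: small_multipleN.
  by rewrite mulrnBr ?(ltnW ji) //; ring.
by move=> wk wk'; have [kk'|kk'|//] := ltngtP k k'; [case: (H k' k)|case: (H k k')].
Qed.

(** Let [b] exceed all the terms of [us]. For each [k], removing any one of the
    [k] largest terms of [us] from their sum, and then adding [b], leads beyond
    every sum of [k] terms. This makes 1 + ... + size us escaping points, besides
    those where [b] is added to the sum of all the terms. *)
Lemma escape_parallel (R : realDomainType) (r y0 b : R) (N N' Q : nat) (A1 us : seq R) :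
  0 < r -> progression r N A1 -> uniq us -> sorted >=%R us ->
  (forall u, u \in us -> u < b) ->
  (forall u, u \in b :: us -> small_multiple r N (u - y0)) ->
  ((size us).+2 * N <= N')%N -> (size us < Q)%N -> far r (N' + N') Q y0 ->
  (#|` subsums A1| + 'C((size us).+1, 2) <=
   escape (sumset (subsums us) (subsums A1)) b)%N.
Proof.
move=> r0 A1P uu us_sorted ltb usP NN' iQ y0far; set T := subsums A1; set X := sumset _ _.
pose class k w := small_multiple r N' (w - y0 *+ k).
have usP' u : u \in us -> small_multiple r N (u - y0).
  by move=> uus; apply: usP; rewrite inE uus orbT.
have T0 : 0 \in T by apply: subsums0.
have classT v t : {subset v <= b :: us} -> (size v <= (size us).+1)%N -> t \in T ->
    class (size v) (\sum_(u <- v) u + t).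
  move=> vus sv tT; apply: (small_multipleW (N := size v * N + N)).
    by apply: leq_trans NN'; rewrite -mulSnr leq_mul2r ltnS sv orbT.
  rewrite addrAC; apply: small_multipleD.
    by apply: small_multiple_sum => u /vus/usP.
  by rewrite -[t]subr0; apply: progression_subsumsB A1P _ _.
have [tm tmT tmax] : exists2 tm, tm \in T & forall t, t \in T -> t <= tm.
  have [tm + tmax] := exists_max 0 (enum_fset T).
  rewrite inE => tmT; exists tm; first by case/orP: tmT => [/eqP->|].
  by move=> t tT; apply: tmax; rewrite inE tT orbT.
pose i := size us.
have cl_uniq k k' w : (k <= Q)%N -> (k' <= Q)%N -> class k w -> class k' w -> k = k'.
  exact: class_unique y0far.
have noX w k : class k w -> (k <= i.+1)%N -> w \in X ->
    exists v t, [/\ subseq v us, size v = k, t \in T & w = \sum_(u <- v) u + t].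
  move=> wk ki /sumsetP[_ [t [/subsumsP[v vs ->] tT E]]].
  exists v, t; split=> //; apply: (cl_uniq _ _ w) => //.
  - by apply: leq_trans (size_subseq vs) _; apply: ltnW.
  - by apply: leq_trans ki _.
  rewrite E; apply: classT => //; last by apply: leq_trans (size_subseq vs) _.
  by move=> u /(mem_subseq vs); rewrite inE orbC => ->.
have addcons v t : \sum_(u <- v) u + t + b = \sum_(u <- b :: v) u + t.
  by rewrite big_cons [b + _]addrC addrAC.
suff H j : (j <= i)%N -> exists Z, [/\ uniq Z, size Z = (#|` T| + 'C(j.+1, 2))%N,
    forall z, z \in Z -> z \in X /\ z + b \notin X &
    forall z, z \in Z -> class i z \/ exists2 k, (k < j)%N & class k z].
  have [//|Z [Zu sZ ZX _]] := H i.
  by rewrite -sZ; apply: escape_ge_size.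
elim: j => [_|j IH ji].
  exists [seq \sum_(u <- us) u + t | t <- T]; split.
  - by rewrite map_inj_uniq ?fset_uniq // => ? ? /addrI.
  - by rewrite size_map addn0.
  - move=> _ /mapP[t tT ->]; split; first by apply: mem_sumset => //; apply: mem_subsums.
    apply/negP => /(noX _ i.+1)[].
    + by rewrite addcons; apply: (classT (b :: us)).
    + by [].
    + by move=> v [t' [vs sv _ _]]; have := size_subseq vs; rewrite sv ltnn.
  move=> _ /mapP[t tT ->]; left; apply: classT => // u uus; by rewrite inE uus orbT.
have [|Z [Zu sZ ZX Zc]] := IH; first exact: ltnW.
pose top := take j.+1 us.
have stop : size top = j.+1 by rewrite size_takel.
have topus : subseq top us by apply: take_subseq.
have utop : uniq top by apply: take_uniq.
pose W := [seq \sum_(u <- top) u - c + tm | c <- top].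
have WE c : c \in top -> \sum_(u <- top) u - c = \sum_(u <- rem c top) u.
  by move=> ctop; rewrite sum_rem.
have Wclass z : z \in W -> class j z.
  move=> /mapP[c ctop ->]; rewrite WE //.
  have -> : j = size (rem c top) by rewrite size_rem // stop.
  apply: classT => //; last by rewrite size_rem // stop; apply: leqW; apply: ltnW.
  by move=> u /mem_rem/(mem_subseq topus); rewrite inE orbC => ->.
exists (Z ++ W); split.
- rewrite cat_uniq Zu map_inj_uniq ?utop ?andbT; last first.
    by move=> c c' /addIr/addrI/oppr_inj.
  apply/hasPn => z zW; apply/negP => /Zc zc.
  have jQ : (j <= Q)%N by apply: ltnW; apply: leq_trans ji (ltnW iQ).
  case: zc => [iz|[k kj kz]].
    by move: ji; rewrite -(cl_uniq _ _ _ (ltnW iQ) jQ iz (Wclass z zW)) ltnn.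
  have kQ : (k <= Q)%N by apply: ltnW; apply: leq_trans kj jQ.
  by move: kj; rewrite (cl_uniq _ _ _ kQ jQ kz (Wclass z zW)) ltnn.
- by rewrite size_cat sZ size_map stop [in RHS]binS bin1 -addnA.
- move=> z; rewrite mem_cat => /orP[/ZX//|/mapP[c ctop ->]].
  have cus : c \in us by apply: (mem_subseq topus).
  split.
    rewrite WE //; apply: mem_sumset => //; apply: mem_subsums.
    exact: subseq_trans (rem_subseq _ _) topus.
  apply/negP => /(noX _ j.+1)[].
  + rewrite WE // addcons.
    have -> : j.+1 = size (b :: rem c top) by rewrite /= size_rem // stop.
    apply: classT => //; last by rewrite /= size_rem // stop /= ltnW.
    by move=> u; rewrite !inE => /orP[->//|/mem_rem/(mem_subseq topus)->]; rewrite orbT.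
  + by rewrite ltnW.
  move=> v [t [vs sv tT E]]; have := ler_sum_take us_sorted vs.
  rewrite sv -/top => /lerD/(_ (tmax _ tT)); rewrite -E leNgt => /negP; apply.
  by rewrite [ltRHS]addrAC ltrD2r -addrA ltrDl addrC subr_gt0; apply: ltb.
move=> z; rewrite mem_cat => /orP[/Zc[iz|[k kj kz]]|/Wclass zj]; [by left| |].
  by right; exists k => //; apply: leq_trans kj _.
by right; exists j.
Qed.

Lemma card_parallel (R : realDomainType) (r y0 : R) (N N' Q : nat) (A1 us : seq R) :
  0 < r -> progression r N A1 -> uniq us ->
  (forall u, u \in us -> small_multiple r N (u - y0)) ->
  ((size us).+1 * N <= N')%N -> (size us <= Q)%N -> far r (N' + N') Q y0 ->
  ((size us).+1 * #|` subsums A1| + 'C((size us).+1, 3) <=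
   #|` sumset (subsums us) (subsums A1)|)%N.
Proof.
move=> r0 A1P.
rewrite -(size_sort >=%R us) -(perm_uniq (permEl (perm_sort >=%R us))).
rewrite -(perm_subsums (permEl (perm_sort >=%R us))) => uu usP.
have {usP} : forall u, u \in sort >=%R us -> small_multiple r N (u - y0).
  by move=> u; rewrite mem_sort; apply: usP.
have := sort_sorted (@ge_total _ R) us.
move: (sort _ us) uu => {}us; elim: us => [|b us IH].
  by rewrite subsums_nil sumset0 /= !mul1n bin_small ?addn0.
move=> /= /andP[bus uu] sb usP NN' iQ y0far.
have ltb u : u \in us -> u < b.
  move=> uus; rewrite lt_neqAle (ge_path_max sb uus) andbT.
  by apply: contraNneq bus => <-.
have us_sorted := path_sorted sb.
rewrite card_sumset_cons mulSn binS [X in (_ + X <= _)%N]addnC.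
rewrite addnACA [leqRHS]addnC addnC [X in (X <= _)%N]addnC; apply: leq_add.
  exact: escape_parallel A1P uu us_sorted ltb usP NN' iQ y0far.
apply: IH => //; first by move=> u uus; apply: usP; rewrite inE uus orbT.
- by apply: leq_trans NN'; rewrite leq_mul2r leqnSn orbT.
- exact: ltnW.
Qed.

Lemma card_sumset1 (G : zmodType) (c : G) (X : {fset G}) :
  #|` sumset [fset c] X| = #|` X|.
Proof.
have -> : sumset [fset c] X = [fset c + x | x in X].
  apply/fsetP => w; apply/sumsetP/imfsetP.
    by move=> [_ [x [/[!inE]/eqP-> xX ->]]]; exists x.
  by move=> [x xX ->]; exists c, x; rewrite inE.
by rewrite card_imfset // => x y /addrI.
Qed.

(** Replacing [y] by [- y] translates the set of subset sums by [- y]. *)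
Lemma subsums_flip (G : zmodType) (u : G -> G) (s : seq G) :
  (forall y, u y = y \/ u y = - y) ->
  exists c, subsums (map u s) = sumset [fset c] (subsums s).
Proof.
move=> uP; elim: s => [|y s [c IH]].
  by exists 0; rewrite sumset0.
have sumsetCA : left_commutative (@sumset G).
  by move=> X Y Z; rewrite !sumsetA (sumsetC X).
rewrite /= !subsums_cons IH; case: (uP y) => ->.
  by exists c; rewrite sumsetCA.
exists (- y + c).
have -> : [fset 0; - y] = sumset [fset - y] [fset 0; y].
  apply/fsetP => w; apply/idP/sumsetP.
    rewrite !inE => /orP[]/eqP->.
      by exists (- y), y; rewrite !inE !eqxx orbT addNr.
    by exists (- y), 0; rewrite !inE !eqxx addr0.
  move=> [_ [x [/[!inE]/eqP-> /orP[]/eqP-> ->]]].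
    by rewrite addr0 eqxx orbT.
  by rewrite addNr eqxx.
have -> : [fset - y + c] = sumset [fset - y] [fset c].
  apply/fsetP => w; apply/idP/sumsetP.
    by rewrite inE => /eqP->; exists (- y), c; rewrite !inE !eqxx.
  by move=> [_ [_ [/[!inE]/eqP-> /eqP-> ->]]].
by rewrite -!sumsetA [sumset [fset 0; y] _]sumsetCA.
Qed.

(** If two elements of [A2] are not congruent up to sign modulo the progression,
    they are independent in one of the two orders, and an additional translate of
    [T] appears. Otherwise changing signs, which only translates the set of sums,
    makes all the elements of [A2] congruent to one of them. The square in [Q]
    comes from the product of two multipliers in [independent_or]; the linear term
    keeps apart the classes of sums of [k] elements, [k <= size A2]. *)
Lemma exact_count (R : realDomainType) (r : R) (N Q : nat) (A1 A2 : seq R) :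
  0 < r -> progression r N A1 -> uniq A2 -> (forall y, y \in A2 -> 0 < y) ->
  (0 < size A2)%N -> Q = (2 ^ size A2 * 2 ^ size A2 + 2 * (size A2).+1)%N ->
  (forall y, y \in A2 -> far r (Q * N) Q y) ->
  ((size A2).+2 * #|` subsums A1| <= #|` subsums (A2 ++ A1)|)%N \/
  ((size A2).+1 * #|` subsums A1| + 'C((size A2).+1, 3) <= #|` subsums (A2 ++ A1)|)%N.
Proof.
move=> r0 A1P A2u A2pos A20 QE A2far; rewrite subsums_cat.
set P := (2 ^ size A2)%N in QE.
have P0 : (0 < P)%N by rewrite expn_gt0.
have [[y1 [y2 [y1A y2A [sub12 add12]]]]|] := pselect (exists y1 y2, [/\ y1 \in A2,
   y2 \in A2 & ~ small_multiple r N (y1 - y2) /\ ~ small_multiple r N (y1 + y2)]).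
  left; have : independent r N P y1 y2 \/ independent r N P y2 y1.
    by apply: independent_or => //; apply: farW (A2far _ y1A); nia.
  have y12 : y1 != y2.
    by apply/eqP => E; apply: sub12; rewrite E subrr; apply: small_multiple0.
  have count y y' : y \in A2 -> y' \in A2 -> y != y' -> independent r N P y y' ->
      ((size A2).+2 * #|` subsums A1| <= #|` sumset (subsums A2) (subsums A1)|)%N.
    move=> yA y'A yy' ind.
    have pA : perm_eq A2 [:: y', y & rem y (rem y' A2)].
      apply: perm_trans (perm_to_rem y'A) _; rewrite perm_cons; apply: perm_to_rem.
      by rewrite mem_rem_uniq // inE yA andbT.
    rewrite (perm_subsums pA) (perm_size pA) /=; apply: card_independent ind => //.
      by rewrite /P (perm_size pA) leq_exp2l //= ltnW.
    move=> z; rewrite -(perm_mem pA) => /A2far.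
    by apply: farW; [have := leq_mul2r N 1 Q|]; nia.
  by case; [apply: count|apply: count; rewrite // eq_sym].
move=> par; right.
have {}par y y' : y \in A2 -> y' \in A2 ->
    small_multiple r N (y - y') \/ small_multiple r N (y + y').
  move=> yA y'A; apply: contrapT => /not_orP[H1 H2].
  by apply: par; exists y, y'.
have [y0 y0A] : exists y0, y0 \in A2.
  by case: (A2) A20 => // y0 s _; exists y0; apply: mem_head.
pose u y := if `[< small_multiple r N (y - y0) >] then y else - y.
have uP y : u y = y \/ u y = - y by rewrite /u; case: ifP; [left|right].
have [c E] := subsums_flip A2 uP.
rewrite -(card_sumset1 c (sumset (subsums A2) _)) sumsetA -E -(size_map u A2).
apply: (@card_parallel _ r y0 N ((size A2).+1 * N) Q) => //.
- rewrite map_inj_in_uniq // => y y' yA y'A uyy'.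
  have := A2pos _ yA; have := A2pos _ y'A.
  by case: (uP y) (uP y') uyy' => -> [] ->; lra.
- move=> _ /mapP[y yA ->]; rewrite /u; case: asboolP => // yy0.
  case: (par _ _ yA y0A) => // ?; rewrite -opprD; exact: small_multipleN.
- by rewrite size_map.
- by rewrite size_map QE; move: (size A2) => a; lia.
apply: farW (A2far _ y0A) => //; rewrite -mulnDl leq_mul2r QE.
by apply/orP; right; move: (size A2) => a; lia.
Qed.

(** * Absorbing exceptional elements *)

Lemma progressionW (R : realDomainType) (r : R) (N N' : nat) (s : seq R) :
  0 < r -> (N <= N')%N -> progression r N s -> progression r N' s.
Proof.
move=> r0 NN' [sP sN]; split=> //; apply: le_trans sN _.
by rewrite ler_pM2l // ler_nat.
Qed.

Lemma leq_bin2_sqr (n : nat) : ('C(n, 2) <= n ^ 2)%N.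
Proof. by case: n => // n; have := double_bin2 n; rewrite -mulnn; lia. Qed.

(** With [m] elements outside [t] exceptional ones, an additional translate is
    worth more than all the lower order terms once [m] is large. *)
Lemma additional_translate (l t m c X : nat) :
  (l < t)%N -> (t + (l + 2) * (2 * t + t * t) + 2 * c + 1 <= m)%N ->
  ((l + 3) * ('C(m.+1, 2) + 1) <= X)%N ->
  ((l + 2) * ('C(m + t - l, 2) + 1) + c <= X)%N.
Proof.
move=> lt mbig; apply: leq_trans.
have a2 := double_bin2 m.
have b2 : (2 * 'C(m + t - l, 2) <= (m + t) * (m + t))%N.
  case E : (m + t - l)%N => [|k]; first by rewrite muln0.
  by rewrite double_bin2; apply: leq_mul; lia.
move: 'C(m.+1, 2) 'C(m + t - l, 2) a2 b2 => a b a2 b2.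
have b3 : (2 * ((l + 2) * b) <= (l + 2) * ((m + t) * (m + t)))%N.
  by rewrite mulnCA leq_mul2l b2 orbT.
have a3 : (2 * ((l + 3) * a) = (l + 3) * (m.+1 * m))%N by rewrite mulnCA a2.
have m2 := leq_mul (leqnn m) mbig.
have m0 : (0 < m)%N by lia.
have E6 : ((l + 2) * (t * t) <= m * ((l + 2) * (t * t)))%N by rewrite leq_pmull.
have E7 : (2 * c <= m * (2 * c))%N by rewrite leq_pmull.
rewrite -(leq_pmul2l (isT : 0 < 2)%N).
have -> : (2 * ((l + 2) * (b + 1) + c) =
           2 * ((l + 2) * b) + 2 * (l + 2) + 2 * c)%N by lia.
have -> : (2 * ((l + 3) * (a + 1)) = 2 * ((l + 3) * a) + 2 * (l + 3))%N by lia.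
rewrite a3; move: b3 m2 E6 E7; set Y := (2 * ((l + 2) * b))%N; clearbody Y.
lia.
Qed.

(** While more than [l] elements are exceptional, one of them has a small multiple
    in the progression, for otherwise the exact count contradicts the bound. It is
    absorbed into a refined progression, whose total grows by a bounded factor. *)
Lemma absorb_exceptions (R : realType) (l s K : nat) :
  exists K' n0 : nat, forall A : seq R, (n0 <= size A)%N -> uniq A ->
  (forall a, a \in A -> 0 < a) ->
  (#|` subsums A| < (l + 2) * ('C(size A - l, 2) + 1) + 'C(l + 2, 3))%N ->
  forall A1 A2 r, perm_eq A (A1 ++ A2) -> 0 < r -> (size A2 <= s)%N ->
    progression r (K * size A ^ 2) A1 ->
  exists A1' A2' r', [/\ perm_eq A (A1' ++ A2'), 0 < r', (size A2' <= l)%N &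
    progression r' (K' * size A ^ 2) A1'].
Proof.
elim: s K => [|s IH] K.
  exists K, 0%N => A _ _ _ _ A1 A2 r AE r0 sA2 A1P.
  by exists A1, A2, r; split=> //; apply: leq_trans sA2 _.
have [sl|ls] := leqP s.+1 l.
  exists K, 0%N => A _ _ _ _ A1 A2 r AE r0 sA2 A1P.
  by exists A1, A2, r; split=> //; apply: leq_trans sA2 _.
pose Q := (2 ^ s.+1 * 2 ^ s.+1 + 2 * s.+2)%N.
have [K' [n0 H]] := IH (Q`! * (1 + Q) * K)%N.
have K2K : (K <= Q`! * (1 + Q) * K)%N by rewrite leq_pmull // muln_gt0 fact_gt0.
pose m0 := (s.+1 + (l + 2) * (2 * s.+1 + s.+1 * s.+1) + 2 * 'C(l + 2, 3) + 1)%N.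
exists K', (n0 + s.+1 + m0)%N.
move=> A nA Au Apos bound A1 A2 r AE r0 sA2 A1P.
have n0A : (n0 <= size A)%N by apply: leq_trans nA; rewrite -addnA leq_addr.
move: sA2; rewrite leq_eqVlt ltnS => /orP[/eqP sA2|sA2]; last first.
  apply: (H A n0A Au Apos bound A1 A2 r AE r0 sA2).
  by apply: progressionW A1P => //; rewrite leq_mul2r K2K orbT.
set n := size A in nA n0A bound A1P H *; set N := (K * n ^ 2)%N in A1P.
have [A1u A2u] : uniq A1 /\ uniq A2.
  by move: Au; rewrite (perm_uniq AE) cat_uniq; case/and3P.
have A1pos y : y \in A1 -> 0 < y.
  by move=> yA; apply: Apos; rewrite (perm_mem AE) mem_cat yA.
have A2pos y : y \in A2 -> 0 < y.
  by move=> yA; apply: Apos; rewrite (perm_mem AE) mem_cat yA orbT.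
have [A2far|] := pselect (forall y, y \in A2 -> far r (Q * N) Q y).
  exfalso; move: bound; rewrite ltnNge => /negP; apply.
  have nE : n = (size A1 + s.+1)%N by rewrite /n (perm_size AE) size_cat sA2.
  have cT := card_subsums_ge A1u A1pos.
  rewrite (perm_subsums AE) (perm_subsums (permEl (perm_catC A1 A2))).
  have mbig : (m0 <= size A1)%N by move: nA; rewrite nE; move: m0 (size A1); lia.
  have additional k : (l + 3 <= k)%N ->
      (k * #|` subsums A1| <= #|` subsums (A2 ++ A1)|)%N ->
      ((l + 2) * ('C(n - l, 2) + 1) + 'C(l + 2, 3) <= #|` subsums (A2 ++ A1)|)%N.
    move=> lk kT; rewrite nE; apply: (additional_translate ls mbig).
    exact: leq_trans (leq_mul lk cT) kT.
  case: (@exact_count _ r N Q A1 A2) => //; rewrite ?sA2 //.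
    by apply: additional; lia.
  move=> count; have [sl|sl] := eqVneq s l.
    apply: leq_trans count; rewrite sl !addn2 leq_add2r leq_mul2l.
    have -> : (n - l = (size A1).+1)%N by rewrite nE sl addnS -addSn addnK.
    by rewrite cT orbT.
  apply: (additional s.+2); first by move: sl; rewrite neq_ltn; lia.
  by apply: leq_trans count; rewrite leq_addr.
move=> /existsNP[y /not_implyP[yA2 yfar]].
have [k k0 [yE yN]] := progression_refine r0 (A2pos _ yA2) yfar.
apply: (H A n0A Au Apos bound (y :: A1) (rem y A2) (r / Q`!%:R)).
- apply: perm_trans AE _; rewrite perm_catC perm_sym cat_cons perm_sym.
  apply: perm_trans (_ : perm_eq _ ((y :: rem y A2) ++ A1)) _.
    by rewrite perm_cat2r perm_to_rem.
  by rewrite cat_cons perm_cons perm_catC.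
- by rewrite divr_gt0 // ltr0n fact_gt0.
- by rewrite size_rem // sA2.
have Q0 : Q`!%:R != 0 :> R by rewrite pnatr_eq0 -lt0n fact_gt0.
split.
  move=> a; rewrite inE => /orP[/eqP->|]; first by exists k.
  case: A1P => A1P _ /A1P[i i0 ->].
  exists (Q`! * i)%N; first by rewrite muln_gt0 fact_gt0.
  by rewrite natrM mulrA divfK.
rewrite big_cons; apply: le_trans (lerD yN (proj2 A1P)) _.
rewrite -mulrDr -natrD -/n -!mulnA -/N natrM mulrA divfK // ler_pM2l // ler_nat.
by rewrite mulnDl mul1n addnC.
Qed.

Lemma FS_subsums (G : zmodType) (A : {fset G}) : FS A = subsums A.
Proof.
apply/fsetP => z; apply/imfsetP/subsumsP => /=.
  move=> [B /[!fpowersetE]/fsubsetP BA ->].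
  exists [seq x <- A | x \in B]; first exact: filter_subseq.
  apply: perm_big; apply: uniq_perm; rewrite ?filter_uniq ?fset_uniq // => x.
  by rewrite mem_filter; case: (boolP (x \in B)) => // /BA ->.
move=> [v vA ->]; have vu := subseq_uniq vA (fset_uniq A).
exists [fset x in v].
  by rewrite fpowersetE; apply/fsubsetP => x; rewrite inE; apply: mem_subseq vA x.
by apply: perm_big; apply: uniq_perm; rewrite ?fset_uniq // => x; rewrite inE.
Qed.

Local Open Scope fset_scope.
Local Open Scope classical_set_scope.

Theorem theorem4p8 (R : realType) (l : nat) :
  exists (K : R) (n0 : nat), 0 < K /\ (0 < n0)%N /\
  forall (n : nat) (A : {fset R}),
    (n0 <= n)%N ->
    (forall x, x \in A -> 0 < x) ->
    #|` A| = n ->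
    (#|` FS A| < (l + 2) * ('C(n - l, 2) + 1) + 'C(l + 2, 3))%N ->
    exists A1 A2 : {fset R},
      A = (A1 `|` A2)%fset /\ (A1 `&` A2)%fset = fset0 /\
      (exists r : R,
         0 < r /\
         [set` A1] `<=` dilate r (pos_integers R) /\
         \sum_(x \in dilate r^-1 [set` A1]) x <= K * n%:R ^+ 2) /\
      (#|` A2| <= l)%N.
Proof.
pose C := (2 * (l + 2) + 'C(l + 2, 3))%N.
have C0 : (0 < C)%N by rewrite /C; lia.
have [K1 [s [n1 rough]]] := progression_up_to_bounded R C0.
have [K [n0 absorb]] := absorb_exceptions R l s K1.
exists K.+1%:R, (n0 + n1).+1; split; first by rewrite ltr0n.
split=> // n A nA Apos An; rewrite FS_subsums => bound.
have n0n : (n0 <= n)%N by apply: leq_trans nA; rewrite -addnS leq_addr.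
have n1n : (n1 <= n)%N by apply: leq_trans nA; rewrite -addSn leq_addl.
have rough_bound : (#|` subsums A| <= C * n ^ 2)%N.
  apply: leq_trans (ltnW bound) _.
  have n2 : (0 < n ^ 2)%N by rewrite expn_gt0 (leq_trans _ nA).
  have binn : ('C(n - l, 2) <= n ^ 2)%N.
    by apply: leq_trans (leq_bin2_sqr _) _; rewrite leq_exp2r // leq_subr.
  rewrite /C [leqRHS]mulnDl; apply: leq_add; last by rewrite leq_pmulr.
  by rewrite [(2 * _)%N]mulnC -mulnA leq_mul2l; apply/orP; right; lia.
subst n.
have [B1 [B2 [r [AB r0 sB2 B1P]]]] := rough A n1n (fset_uniq A) Apos rough_bound.
have {B1 B2 r AB r0 sB2 B1P}[A1 [A2 [r [AE r0 sA2 [A1P A1N]]]]] :=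
  absorb A n0n (fset_uniq A) Apos bound _ _ _ AB r0 sB2 B1P.
have : uniq (A1 ++ A2) by rewrite -(perm_uniq AE) fset_uniq.
rewrite cat_uniq => /and3P[A1u /hasPn A12 A2u].
exists [fset x in A1], [fset x in A2]; split.
  by apply/fsetP => x; rewrite !inE (perm_mem AE) mem_cat.
split.
  apply/fsetP => x; rewrite !inE; apply/negP => /andP[xA1 /A12].
  by rewrite /= xA1.
split; last by rewrite card_fseq undup_id.
exists r; split=> //; split.
  move=> x /=; rewrite inE => /A1P[k k0 ->].
  by exists k%:~R => //; exists k%:Z.
have -> : dilate r^-1 [set` [fset x in A1]] = [set` [seq r^-1 * a | a <- A1]].
  apply/seteqP; split=> x.
    by move=> [a /=]; rewrite inE => aA1 <-; apply/map_f.
  by move=> /mapP[a aA1 ->]; exists a => //=; rewrite inE.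
rewrite -fsbig_seq; last first.
  by rewrite map_inj_uniq //; apply: mulfI; rewrite invr_neq0 // lt0r_neq0.
rewrite big_map -mulr_sumr mulrC ler_pdivrMr // -natrX -natrM mulrC.
by apply: le_trans A1N _; rewrite ler_pM2l // ler_nat leq_mul2r leqnSn orbT.
Qed.
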